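(* Assume the diffusion, nonlinearity, wave, spectral and noise-coefficient assumptions of the context. Let $K>0$ be sufficiently large and $\delta_\sigma>0$ be such that for every $0\le\sigma\le\delta_\sigma$ there is a unique pair $(\Phi_\sigma,c_\sigma)\in\mathcal U_{H^2}\times\mathbb R$ satisfying $$A_*\Phi_\sigma+\mathcal J_\sigma(\Phi_\sigma,c_\sigma,\psi_{\rm tw})=0,\qquad \|\Phi_\sigma-\Phi_0\|_{H^2}+|c_\sigma-c_0|\le K\sigma^2 .$$ Suppose that $g(\Phi_0)=\vartheta_0\Phi_0'$ for some $\vartheta_0\in\mathbb R$. Then for all sufficiently small $0\le\sigma\le\delta_\sigma$ we have the identities $$\Phi_\sigma(\xi)=\Phi_0\Big(\big[1+\tfrac{1}{2\rho}\sigma^2\vartheta_0^2\big]^{1/2}\xi\Big),\qquad c_\sigma=\big[1+\tfrac1{2\rho}\sigma^2\vartheta_0^2\big]^{-1/2}c_0,$$ together with $$g(\Phi_\sigma)=\big[1+\tfrac1{2\rho}\sigma^2\vartheta_0^2\big]^{-1/2}\vartheta_0\Phi_\sigma'=-b(\Phi_\sigma,\psi_{\rm tw})\Phi_\sigma'.$$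
   Context: Fix $n\ge1$; $L^2=L^2(\mathbb R;\mathbb R^n)$, $H^k=H^k(\mathbb R;\mathbb R^n)$ with standard inner product $\langle\cdot,\cdot\rangle_{L^2}$. Diffusion: $A_*u=\rho u''$ with $\rho>0$. Nonlinearity: $f\in C^3(\mathbb R^n;\mathbb R^n)$, $|D^3f(u)|\le K_f$ for all $u$, and $f(u_-)=f(u_+)=0$ for some $u_\pm\in\mathbb R^n$. Wave: there are $\Phi_0\in C^2(\mathbb R;\mathbb R^n)$, $c_0\in\mathbb R$ such that $u(x,t)=\Phi_0(x-c_0t)$ solves $u_t=A_*u+f(u)$ on $\mathbb R\times\mathbb R$, and constants $K',\nu_\pm>0$ with $|\Phi_0(\xi)-u_-|+|\Phi_0'(\xi)|\le K'e^{-\nu_-|\xi|}$ for $\xi\le0$ and $|\Phi_0(\xi)-u_+|+|\Phi_0'(\xi)|\le K'e^{-\nu_+|\xi|}$ for $\xi\ge0$. Spectral: let $\mathcal L_{\rm tw}v=c_0v'+A_*v+Df(\Phi_0)v$ and $\mathcal L_{\rm tw}^{\rm adj}w=-c_0w'+A_*w+Df(\Phi_0)^Tw$, as maps $H^2\to L^2$. There is $\beta>0$ such that $\mathcal L_{\rm tw}-\lambda$ is invertible for all $\lambda\in\mathbb C\setminus\{0\}$ with $\mathrm{Re}\,\lambda\ge-2\beta$; $\mathcal L_{\rm tw}$ is Fredholm of index zero; $\ker\mathcal L_{\rm tw}=\mathrm{span}\{\Phi_0'\}$, $\ker\mathcal L_{\rm tw}^{\rm adj}=\mathrm{span}\{\psi_{\rm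 tw}\}$ with $\psi_{\rm tw}\in H^2$, $\langle\Phi_0',\psi_{\rm tw}\rangle_{L^2}=1$. Noise coefficient: $g\in C^2(\mathbb R^n;\mathbb R^n)$, $g(u_\pm)=0$, and for some $K_g>0$: $|Dg(u)|\le K_g$ and $|g(u_A)-g(u_B)|+|Dg(u_A)-Dg(u_B)|\le K_g|u_A-u_B|$ for all arguments. Auxiliary functions: $\mathcal U_{H^k}=\Phi_0+H^k$, $K_{\rm ip}=[\|g(\Phi_0)\|_{L^2}+2K_g]\|\psi_{\rm tw}\|_{L^2}$. Fix $C^\infty$ non-decreasing $\chi_{\rm low}:\mathbb R\to[\frac14,\infty)$ and $\chi_{\rm high}:\mathbb R\to[-K_{\rm ip}-1,K_{\rm ip}+1]$ with $\chi_{\rm low}(\vartheta)=\frac14$ for $\vartheta\le\frac14$, $\chi_{\rm low}(\vartheta)=\vartheta$ for $\vartheta\ge\frac12$; $\chi_{\rm high}(\vartheta)=\vartheta$ for $|\vartheta|\le K_{\rm ip}$, $\chi_{\rm high}(\vartheta)=\mathrm{sign}(\vartheta)(K_{\rm ip}+1)$ for $|\vartheta|\ge K_{\rm ip}+1$. For $u\in\mathcal U_{H^1}$, $c\in\mathbb R$, $\psi\in H^1$ put $b(u,\psi)=-[\chi_{\rm low}(\langle\partial_\xi u,\psi\rangle_{L^2})]^{-1}\chi_{\rm high}(\langle g(u),\psi\rangle_{L^2})$, $\kappa_\sigma(u,\psi)=1+\frac{1}{2\rho}\sigma^2b(u,\psi)^2$, $\mathcal J_\sigma(u,c,\psi)=\kappa_\sigma(u,\psi)^{-1}[f(u)+cu'+\sigma^2b(u,\psi)\partial_\xi(g(u))]$.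 *)

(* Defs.v *)
From HB Require Import structures.
From mathcomp Require Import all_boot all_order all_algebra.
From mathcomp Require Import all_classical all_reals all_analysis.
From mathcomp Require Export complex.

Set Implicit Arguments.
Unset Strict Implicit.
Unset Printing Implicit Defensive.

Import Order.TTheory GRing.Theory Num.Theory numFieldNormedType.Exports.

Local Open Scope classical_set_scope.
Local Open Scope ring_scope.

(* Vectors of R^n are row vectors.  The library norm on 'rV[R]_n is the sup
   norm (same topology), so the Euclidean norm is introduced separately. *)
Section Euclidean.
Context {R : realType} {n : nat}.

Definition dot (u v : 'rV[R]_n) : R := \sum_(i < n) u ord0 i * v ord0 i.

Definition enorm (u : 'rV[R]_n) : R := Num.sqrt (dot u u).

Definition opnorm (A : 'M[R]_n) : R :=
  sup [set enorm (h *m A) | h in [set h : 'rV[R]_n | enorm h <= 1]].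

(* Operator norm of the trilinear map D^3 f(u). *)
Definition D3norm (f : 'rV[R]_n -> 'rV[R]_n) (u : 'rV[R]_n) : R :=
  sup [set r | exists h1 h2 h3 : 'rV[R]_n,
    [/\ enorm h1 <= 1, enorm h2 <= 1, enorm h3 <= 1 &
        r = enorm ('D_h3 (fun x => 'D_h2 (fun y => 'D_h1 f y) x) u)]].

End Euclidean.

Fixpoint Ck {R : realType} {V W : normedModType R} (k : nat) (f : V -> W)
    : Prop :=
  if k is k'.+1 then
    (forall x, differentiable f x) /\ (forall v, Ck k' (fun x => 'D_v f x))
  else continuous f.

(* Elements of L^2 and H^k are represented by (Borel measurable) functions;
   two representatives are identified when they agree almost everywhere. *)
Section Sobolev.
Context {R : realType} {n : nat}.
Notation mu := (@lebesgue_measure R).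
Implicit Types u v : R -> 'rV[R]_n.

Definition ae_eq_fun {T : Type} (u v : R -> T) : Prop :=
  {ae mu, forall x, u x = v x}.

Definition L2 u : Prop :=
  forall i, (fun x => u x ord0 i) \in Lfun mu 2%:E.

Definition L2dot u v : R := \int[mu]_x dot (u x) (v x).

Definition L2norm u : R := Num.sqrt (L2dot u u).

(* C^1 test functions give the same weak derivative as smooth ones, by
   mollification. *)
Definition test_function (phi : R -> R) : Prop :=
  Ck 1 phi /\ exists M : R, forall x, M < `|x| -> phi x = 0.

Definition is_weak_deriv u v : Prop :=
  [/\ forall i, locally_integrable setT (fun x => u x ord0 i),
      forall i, locally_integrable setT (fun x => v x ord0 i) &
      forall phi, test_function phi -> forall i,
        \int[mu]_x (u x ord0 i * derive1 phi x) =
        - \int[mu]_x (v x ord0 i * phi x)].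

(* A version of the weak derivative (unique up to null sets); the zero
   function when there is none. *)
Definition wderiv u : R -> 'rV[R]_n :=
  xget (fun=> 0) [set v | is_weak_deriv u v].

Fixpoint Hk (k : nat) u : Prop :=
  if k is k'.+1 then L2 u /\ exists2 v, is_weak_deriv u v & Hk k' v
  else L2 u.

Definition Hknorm (k : nat) u : R :=
  Num.sqrt (\sum_(j < k.+1) L2norm (iter j wderiv u) ^+ 2).

End Sobolev.

(* Maps H^2 -> L^2, extended to complex scalars via v = Re v + i Im v. *)
Section Operators.
Context {R : realType} {n : nat}.
Notation rfun := (R -> 'rV[R]_n).
Notation cfun := (R -> 'rV[R[i]]_n).
Implicit Types (L : rfun -> rfun) (v : cfun).

Definition ReF v : rfun := fun x => map_mx (@complex.Re R) (v x).
Definition ImF v : rfun := fun x => map_mx (@complex.Im R) (v x).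

Definition HkC (k : nat) v : Prop := Hk k (ReF v) /\ Hk k (ImF v).

Definition HknormC (k : nat) v : R :=
  Num.sqrt (Hknorm k (ReF v) ^+ 2 + Hknorm k (ImF v) ^+ 2).

Definition complexify L v : cfun :=
  fun x => map_mx (real_complex R) (L (ReF v) x)
           + 'i%C *: map_mx (real_complex R) (L (ImF v) x).

Definition shifted L (lambda : R[i]) v : cfun :=
  fun x => complexify L v x - lambda *: v x.

(* L - lambda : H^2(R;C^n) -> L^2(R;C^n) is a bijection with bounded inverse. *)
Definition invertible_at L (lambda : R[i]) : Prop :=
  [/\ forall v, HkC 2 v -> HkC 0 (shifted L lambda v),
      forall v, HkC 2 v -> ae_eq_fun (shifted L lambda v) (fun=> 0) ->
        ae_eq_fun v (fun=> 0),
      forall h, HkC 0 h ->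
        exists2 v, HkC 2 v & ae_eq_fun (shifted L lambda v) h &
      exists C : R, forall v, HkC 2 v ->
        HknormC 2 v <= C * HknormC 0 (shifted L lambda v)].

Definition lincomb (d : nat) (a : 'I_d -> R) (w : 'I_d -> rfun) : rfun :=
  fun x => \sum_(j < d) a j *: w j x.

Definition kernel_dim L (d : nat) : Prop :=
  exists w : 'I_d -> rfun,
    [/\ forall j, Hk 2 (w j) /\ ae_eq_fun (L (w j)) (fun=> 0),
        forall a, ae_eq_fun (lincomb a w) (fun=> 0) -> forall j, a j = 0 &
        forall u, Hk 2 u -> ae_eq_fun (L u) (fun=> 0) ->
          exists a, ae_eq_fun u (lincomb a w)].

Definition range_codim L (d : nat) : Prop :=
  exists w : 'I_d -> rfun,
    [/\ forall j, L2 (w j),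
        forall u a, Hk 2 u ->
          ae_eq_fun (fun x => L u x + lincomb a w x) (fun=> 0) ->
          forall j, a j = 0 &
        forall h, L2 h -> exists2 u, Hk 2 u &
          exists a, ae_eq_fun h (fun x => L u x + lincomb a w x)].

Definition closed_range L : Prop :=
  forall h, L2 h ->
    (forall e : R, 0 < e ->
       exists2 u, Hk 2 u & L2norm (fun x => h x - L u x) < e) ->
    exists2 u, Hk 2 u & ae_eq_fun h (L u).

Definition fredholm_index L (m : int) : Prop :=
  (forall u, Hk 2 u -> L2 (L u)) /\ closed_range L /\
  exists p q : nat, [/\ kernel_dim L p, range_codim L q & m = p%:Z - q%:Z].

Definition kernel_is_span L (w : rfun) : Prop :=
  Hk 2 w /\ forall u, Hk 2 u ->
    (ae_eq_fun (L u) (fun=> 0) <->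
     exists a : R, ae_eq_fun u (fun x => a *: w x)).

End Operators.

Section TravelingWaves.
Context {R : realType} {n : nat}.
Implicit Types (rho c sigma : R) (f g : 'rV[R]_n -> 'rV[R]_n)
  (u psi Phi : R -> 'rV[R]_n).

Definition A_star rho u : R -> 'rV[R]_n := fun x => rho *: wderiv (wderiv u) x.

Definition L_tw rho f Phi c u : R -> 'rV[R]_n :=
  fun x => c *: wderiv u x + A_star rho u x + u x *m jacobian f (Phi x).

Definition L_tw_adj rho f Phi c u : R -> 'rV[R]_n :=
  fun x => - c *: wderiv u x + A_star rho u x + u x *m (jacobian f (Phi x))^T.

Definition nonlinearity_assumption f (um up : 'rV[R]_n) : Prop :=
  [/\ Ck 3 f, exists Kf : R, forall x : 'rV[R]_n, D3norm f x <= Kf, f um = 0 & f up = 0].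

Definition solves_RDE rho f (u : R -> R -> 'rV[R]_n) : Prop :=
  forall x t : R,
    derive1 (fun s => u x s) t =
    rho *: derive1 (fun y => derive1 (fun z => u z t) y) x + f (u x t).

Definition wave_assumption rho f (um up : 'rV[R]_n) Phi c : Prop :=
  [/\ Ck 2 Phi,
      solves_RDE rho f (fun x t => Phi (x - c * t)) &
      exists K' num nup : R, [/\ 0 < K', 0 < num, 0 < nup,
        forall xi, xi <= 0 ->
          enorm (Phi xi - um) + enorm (derive1 Phi xi)
            <= K' * expR (- num * `|xi|) &
        forall xi, 0 <= xi ->
          enorm (Phi xi - up) + enorm (derive1 Phi xi)
            <= K' * expR (- nup * `|xi|)]].

Definition spectral_assumption rho f Phi c psi : Prop :=
  [/\ exists2 beta : R, 0 < beta &
        forall lambda : R[i], lambda != 0 ->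
          - (2 * beta) <= complex.Re lambda ->
          invertible_at (L_tw rho f Phi c) lambda,
      fredholm_index (L_tw rho f Phi c) 0,
      kernel_is_span (L_tw rho f Phi c) (derive1 Phi),
      kernel_is_span (L_tw_adj rho f Phi c) psi &
      L2dot (derive1 Phi) psi = 1].

Definition noise_assumption g (Kg : R) (um up : 'rV[R]_n) : Prop :=
  [/\ Ck 2 g, g um = 0 /\ g up = 0, 0 < Kg,
      forall x : 'rV[R]_n, opnorm (jacobian g x) <= Kg &
      forall uA uB : 'rV[R]_n,
        enorm (g uA - g uB) + opnorm (jacobian g uA - jacobian g uB)
          <= Kg * enorm (uA - uB)].

Definition K_ip g (Kg : R) Phi psi : R :=
  (L2norm (fun x => g (Phi x)) + 2 * Kg) * L2norm psi.

Definition cutoff_low (chi : R -> R) : Prop :=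
  [/\ forall k, Ck k chi,
      {homo chi : x y / x <= y},
      forall x, 4^-1 <= chi x,
      forall x, x <= 4^-1 -> chi x = 4^-1 &
      forall x, 2^-1 <= x -> chi x = x].

Definition cutoff_high (K : R) (chi : R -> R) : Prop :=
  [/\ forall k, Ck k chi,
      {homo chi : x y / x <= y},
      forall x, - K - 1 <= chi x <= K + 1,
      forall x, `|x| <= K -> chi x = x &
      forall x, K + 1 <= `|x| -> chi x = Num.sg x * (K + 1)].

Definition b_fun (chi_low chi_high : R -> R) g u psi : R :=
  - (chi_low (L2dot (wderiv u) psi))^-1
  * chi_high (L2dot (fun x => g (u x)) psi).

Definition kappa (chi_low chi_high : R -> R) rho g sigma u psi : R :=
  1 + (2 * rho)^-1 * sigma ^+ 2 * b_fun chi_low chi_high g u psi ^+ 2.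

Definition J_fun (chi_low chi_high : R -> R) rho f g sigma u c psi
    : R -> 'rV[R]_n :=
  fun x => (kappa chi_low chi_high rho g sigma u psi)^-1 *:
    (f (u x) + c *: wderiv u x
     + (sigma ^+ 2 * b_fun chi_low chi_high g u psi)
         *: wderiv (fun y => g (u y)) x).

Definition affine_Hk (k : nat) Phi0 u : Prop := Hk k (fun x => u x - Phi0 x).

Definition wave_pair (chi_low chi_high : R -> R) rho f g Phi0 c0 psi
    (K : R) sigma Phi c : Prop :=
  [/\ affine_Hk 2 Phi0 Phi,
      ae_eq_fun
        (fun x => A_star rho Phi x
                  + J_fun chi_low chi_high rho f g sigma Phi c psi x)
        (fun=> 0) &
      Hknorm 2 (fun x => Phi x - Phi0 x) + `|c - c0| <= K * sigma ^+ 2].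

Definition unique_wave_pair (chi_low chi_high : R -> R) rho f g Phi0 c0 psi
    (K : R) sigma : Prop :=
  (exists Phi c,
     wave_pair chi_low chi_high rho f g Phi0 c0 psi K sigma Phi c) /\
  (forall Phi c Phi' c',
     wave_pair chi_low chi_high rho f g Phi0 c0 psi K sigma Phi c ->
     wave_pair chi_low chi_high rho f g Phi0 c0 psi K sigma Phi' c' ->
     ae_eq_fun Phi Phi' /\ c = c').

End TravelingWaves.

(* Main.v *)
Require Import Defs.
From HB Require Import structures.
From mathcomp Require Import all_boot all_order all_algebra.
From mathcomp Require Import all_classical all_reals all_analysis.
From mathcomp Require Import measurable_realfun ring lra.
Import Order.TTheory GRing.Theory Num.Theory numFieldNormedType.Exports.
Local Open Scope classical_set_scope.
Local Open Scope ring_scope.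
Set Implicit Arguments.
Unset Strict Implicit.
Unset Printing Implicit Defensive.

(* Let [a ^+ 2 = 1 + (2 * rho)^-1 * sigma ^+ 2 * theta0 ^+ 2] and
   [u x = Phi0 (a * x)].  Since [g (Phi0 x) = theta0 *: Phi0' x], the noise
   term is [g u = (theta0 / a) *: u'], so [b (u, psi) = - theta0 / a] as soon
   as the cut-offs are inactive, and dilating the wave equation of [Phi0] shows
   that [(u, c0 / a)] solves the stochastic wave equation.  The exponential
   decay of [Phi0 - u_pm] and [Phi0'] makes the first two derivatives of
   [u - Phi0] square integrable, of size [O(a ^+ 2 - 1) = O(sigma ^+ 2)]; hence
   the cut-offs are inactive for small [sigma], [(u, c0 / a)] lies in the ball
   where the wave pair is unique, and it is the given pair. *)

(** * Weak derivatives *)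

Section ScalarWeakDerivatives.
Context {R : realType}.
Notation mu := (@lebesgue_measure R).
Implicit Types (F w phi : R -> R).

(** The equation is stated through [wderiv], a weak derivative picked by choice, so nothing can be
    computed from it before weak derivatives are known to be unique almost everywhere. With C^1 test
    functions this is a du Bois-Reymond lemma, obtained here from Lebesgue points. For the profile,
    the obstacle is that [Phi0] itself need not be square integrable and that no third derivative is
    at hand. Only increments under dilation are estimated, and those of [Phi0''] are read off the
    wave equation, which expresses [Phi0''] through [Phi0'] and [f (Phi0)]. The factor [a ^+ 2 - 1]
    in all bounds is an exact multiple of [sigma ^+ 2], the scale of the radius of the uniqueness
    ball. Membership in that ball is therefore a condition on [K] alone, whereas the cut-offs are
    what forces [sigma] to be small. *)

Definition C1_deriv F (F' : R -> R) :=
  (forall x : R, is_derive x 1 F (F' x)) /\ continuous F'.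

Lemma is_derive_continuous F (F' : R -> R) :
  (forall x : R, is_derive x 1 F (F' x)) -> continuous F.
Proof.
move=> dF x; apply/differentiable_continuous/derivable1_diffP.
by have [] := dF x.
Qed.

Lemma C1_deriv_Ck F (F' : R -> R) : C1_deriv F F' -> Ck 1 F.
Proof.
move=> [dF cF']; split=> [x|v].
  by apply/derivable1_diffP; have [] := dF x.
have -> : (fun x => 'D_v F x) = (fun x => v * F' x).
  apply/funext => x; have [dFx <-] := dF x.
  rewrite !deriveE; [|exact/derivable1_diffP..].
  by rewrite -{1}(mulr1 v) -[v * 1]/(v *: (1 : R)) linearZ.
by move=> x; apply: cvgM; [exact: cvg_cst|exact: cF'].
Qed.

Lemma Ck_C1_deriv F : Ck 1 F -> C1_deriv F (derive1 F).
Proof.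
move=> [dF cF]; split=> [x|].
  rewrite derive1E; apply/derivableP/derivable1_diffP; exact: dF.
have -> : derive1 F = (fun x => 'D_1 F x) by apply/funext => x; rewrite derive1E.
exact: cF.
Qed.

Lemma continuous_locally_integrable F :
  continuous F -> locally_integrable setT F.
Proof.
move=> cF; split; [exact: continuous_measurable_fun|exact: openT|].
move=> K _ cK.
have /integrableP[] : mu.-integrable K (EFin \o F).
  by apply: continuous_compact_integrable => //; exact: continuous_subspaceT.
by [].
Qed.

Lemma locally_integrable_itv w a b :
  locally_integrable setT w -> mu.-integrable `[a, b] (EFin \o w).
Proof.
move=> [mw _ iw]; apply/integrableP; split.
  by apply/measurable_EFinP; exact: measurable_funTS.
by apply: iw => //; exact: segment_compact.
Qed.

Lemma restrict_support F (M : R) : (forall x, M < `|x| -> F x = 0) ->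
  F \_ (`[- M, M]%classic) = F.
Proof.
move=> F0; apply/funext => x; rewrite patchE; case: ifPn => // xM.
rewrite F0// ltNge; apply: contra xM; rewrite ler_norml => xM.
by rewrite inE/= in_itv.
Qed.

Lemma integrable_support F (M : R) : (forall x, M < `|x| -> F x = 0) ->
  mu.-integrable `[- M, M] (EFin \o F) -> mu.-integrable setT (EFin \o F).
Proof.
move=> F0 iF; rewrite -(restrict_support F0) -restrict_EFin.
by rewrite -integrable_mkcond.
Qed.

Lemma Rintegral_support F (M : R) : (forall x, M < `|x| -> F x = 0) ->
  \int[mu]_x F x = \int[mu]_(x in `[- M, M]) F x.
Proof.
by move=> F0; rewrite [RHS]Rintegral_mkcond restrict_support.
Qed.

Lemma integrable_mul_support w phi (M : R) :
  locally_integrable setT w -> continuous phi ->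
  (forall x, M < `|x| -> phi x = 0) ->
  mu.-integrable setT (EFin \o (fun x => w x * phi x)).
Proof.
move=> lw cphi phi0.
apply: (@integrable_support _ M) => [x /phi0 ->|]; first by rewrite mulr0.
have bphi : [bounded phi x | x in `[- M, M]%classic].
  have /compact_bounded[B [Br BM]] : compact (phi @` `[- M, M]).
    apply: continuous_compact; last exact: segment_compact.
    exact: continuous_subspaceT.
  by exists B; split=> // y yB x xM /=; apply: (BM y yB); exists x.
have mphi : measurable_fun `[- M, M] phi.
  by apply: measurable_funTS; exact: continuous_measurable_fun.
exact: (integrableMl _ (locally_integrable_itv _ _ lw) mphi bphi).
Qed.

Lemma derive1_support phi (M : R) :
  (forall x, M < `|x| -> phi x = 0) -> forall x, M < `|x| -> derive1 phi x = 0.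
Proof.
move=> phi0 x xM; rewrite derive1E -(derive_cst (0 : R) x 1).
apply: near_eq_derive.
have : `|y| @[y --> x] --> `|x| by exact: cvg_norm cvg_id.
move/cvgrPdist_lt => /(_ (`|x| - M)); rewrite subr_gt0 => /(_ xM).
apply: filterS => y; rewrite ltr_distlC => /andP[xy _].
by rewrite phi0//; move: xy; lra.
Qed.

Lemma integral_by_parts_test F (F' : R -> R) phi :
  C1_deriv F F' -> test_function phi ->
  \int[mu]_x (F x * derive1 phi x) = - \int[mu]_x (F' x * phi x).
Proof.
move=> [dF cF'] [/Ck_C1_deriv[dphi cphi'] [M phi0]].
have cF := is_derive_continuous dF; have cphi := is_derive_continuous dphi.
(* [M] may be negative and [phi] is only known to vanish strictly beyond it; with [N] positive and
   larger than [M], the boundary terms at [N] and [- N] are zero. *)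
pose N := `|M| + 1.
have MN : M < N by rewrite (le_lt_trans (ler_norm M))// ltrDl.
have N0 : 0 < N by rewrite ltr_wpDl.
have phiN x : N < `|x| -> phi x = 0 by move=> /(lt_trans MN); exact: phi0.
rewrite (@Rintegral_support _ N); last first.
  by move=> x /(lt_trans MN) /(derive1_support phi0) ->; rewrite mulr0.
rewrite (@Rintegral_support (fun x => F' x * phi x) N); last first.
  by move=> x /phiN ->; rewrite mulr0.
rewrite (@Rintegration_by_parts R F phi F' (derive1 phi)).
- rewrite !phi0 ?normrN ?gtr0_norm// !mulr0 subrr sub0r//.
- lra.
- exact: continuous_subspaceT.
- split=> [x _||]; first by have [] := dF x.
    exact: cvg_at_right_filter (cF _).
  exact: cvg_at_left_filter (cF _).
- by move=> x _; rewrite derive1E; have [] := dF x.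
- exact: continuous_subspaceT.
- split=> [x _||]; first by have [] := dphi x.
    exact: cvg_at_right_filter (cphi _).
  exact: cvg_at_left_filter (cphi _).
- by [].
Qed.

(* [max(0, r ^+ 2 - (y - x) ^+ 2) ^+ 2], written with [max(0, t) ^+ 2 =
   (t ^+ 2 + t * `|t|) / 2] to differentiate it. *)
Definition bump_fun (x r y : R) : R :=
  ((r ^+ 2 - (y - x) ^+ 2) ^+ 2 +
   (r ^+ 2 - (y - x) ^+ 2) * `|r ^+ 2 - (y - x) ^+ 2|) / 2.

Lemma is_derive_mul_norm (x : R) : is_derive x 1 (fun y : R => y * `|y|) (2 * `|x|).
Proof.
have [x0|x0|->] := ltgtP x 0.
- apply: (@near_eq_is_derive _ _ _ (fun y : R => - (y * y))).
    near do rewrite ltr0_norm ?mulrN//; exact: lt_nbhsl.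
  by apply: is_derive_eq; rewrite ltr0_norm// /GRing.scale/=; ring.
- apply: (@near_eq_is_derive _ _ _ (fun y : R => y * y)).
    near do rewrite gtr0_norm//; exact: lt_nbhsr.
  by apply: is_derive_eq; rewrite gtr0_norm// /GRing.scale/=; ring.
(* At 0 the difference quotient is [|y|] itself, which is continuous with value 0. *)
- apply/is_derive1_caratheodory; exists (fun y => `|y|); split.
  + by move=> z; rewrite mul0r !subr0 mulrC.
  + exact: norm_continuous.
  + by rewrite normr0 mulr0.
Unshelve. all: by end_near. Qed.

Lemma continuous_norm_comp (F : R -> R) :
  continuous F -> continuous (fun y => `|F y|).
Proof. by move=> cF y; apply: cvg_norm; exact: cF. Qed.

Lemma ler_sqr_norm (x y : R) : (x ^+ 2 <= y ^+ 2) = (`|x| <= `|y|).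
Proof.
by rewrite -(real_normK (num_real x)) -(real_normK (num_real y)) ler_sqr ?nnegrE.
Qed.

Lemma bump_out x r y : `|r| <= `|y - x| -> bump_fun x r y = 0.
Proof.
move=> ry; rewrite /bump_fun.
have : r ^+ 2 - (y - x) ^+ 2 <= 0.
  by rewrite subr_le0 ler_sqr_norm.
move/ler0_norm => ->; ring.
Qed.

Lemma bump_inE x r y : `|y - x| <= `|r| ->
  bump_fun x r y = (r ^+ 2 - (y - x) ^+ 2) ^+ 2.
Proof.
move=> ry; rewrite /bump_fun.
have : 0 <= r ^+ 2 - (y - x) ^+ 2.
  by rewrite subr_ge0 ler_sqr_norm.
by move/ger0_norm => ->; field.
Qed.

Lemma bump_itv x r y : 0 <= r -> 0 <= bump_fun x r y <= r ^+ 4.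
Proof.
move=> r0; have [ry|/ltW ry] := leP `|r| `|y - x|.
  by rewrite bump_out// lexx exprn_ge0.
rewrite bump_inE// sqr_ge0/= (_ : r ^+ 4 = (r ^+ 2) ^+ 2); last by rewrite -exprM.
have : 0 <= r ^+ 2 - (y - x) ^+ 2.
  by rewrite subr_ge0 ler_sqr_norm.
move=> h; rewrite ler_sqr ?nnegrE ?sqr_ge0//.
by rewrite lerBlDr lerDl sqr_ge0.
Qed.

(** With [W] the parabola inside the bump, the map [t -> t * |t|] has the continuous derivative
    [2 * |t|], so the clipped square has derivative [(W + |W|) * W']: the squaring is what makes the
    truncation C^1. *)
Lemma test_bump x r : test_function (bump_fun x r).
Proof.
split.
  pose W y : R := r ^+ 2 - (y - x) ^+ 2.
  pose dW y : R := - 2 * (y - x).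
  have dWE (y : R) : is_derive y 1 W (dW y).
    by apply: is_derive_eq; rewrite /dW /GRing.scale/=; ring.
  have cW := is_derive_continuous dWE.
  apply: (@C1_deriv_Ck _ (fun y => (W y + `|W y|) * dW y)); split.
    move=> y.
    have dq : is_derive y 1 (fun y => W y * `|W y|) (2 * `|W y| * dW y).
      exact: (@is_derive1_comp _ (fun y => y * `|y|) W _ _ _
        (is_derive_mul_norm _) (dWE y)).
    have -> : bump_fun x r = (2^-1 *: (W * W + (fun y => W y * `|W y|))) :> (R -> R).
      by apply/funext => z; rewrite /bump_fun fctE mulrC.
    by apply: is_derive_eq; rewrite /GRing.scale/=; field.
  move=> y; apply: cvgM.
    by apply: cvgD; [exact: cW|exact: continuous_norm_comp].
  apply: cvgM; first exact: cvg_cst.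
  by apply: cvgB; [exact: cvg_id|exact: cvg_cst].
exists (`|x| + `|r|) => y xry; apply: bump_out.
by have := lerB_dist y x; move: xry; lra.
Qed.

Lemma bump_continuous x r : continuous (bump_fun x r).
Proof.
have [/Ck_C1_deriv[dphi _] _] := test_bump x r.
exact: is_derive_continuous dphi.
Qed.

(* Test against [bump_fun x r], which is at most [r ^+ 4] and has integral at least
   [9 / 16 * r ^+ 5]. *)
Lemma weakly_zero_bound w x r : locally_integrable setT w -> 0 < r ->
  (forall phi, test_function phi -> \int[mu]_y (w y * phi y) = 0) ->
  ((9 / 32 * `|w x|)%:E <= davg w x r)%E.
Proof.
move=> lw r0 w0.
have lwx : locally_integrable setT (fun y => w y - w x).
  apply: locally_integrableB lw _; apply: continuous_locally_integrable.
  exact: cst_continuous.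
have lci : mu.-integrable setT (EFin \o bump_fun x r).
  have l1 : locally_integrable setT (cst 1 : R -> R).
    by apply: continuous_locally_integrable; exact: cst_continuous.
  have [_ [M phi0]] := test_bump x r.
  have := integrable_mul_support l1 (@bump_continuous x r) phi0.
  by congr (mu.-integrable _ _); apply/funext => y /=; rewrite mul1r.
have lcw u : locally_integrable setT u ->
    mu.-integrable setT (EFin \o (fun y => u y * bump_fun x r y)).
  move=> lu; have [_ [M phi0]] := test_bump x r.
  exact: integrable_mul_support lu (@bump_continuous x r) phi0.
have iB : mu.-integrable (ball x r) (EFin \o (fun y => w y - w x)).
  apply: (@integrableS _ _ _ mu `[x - r, x + r]%classic) => //.
  - exact: measurable_ball.
  - by rewrite ball_itv; apply: subset_itvW => //.
  - exact: locally_integrable_itv.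
have iBphi : mu.-integrable (ball x r)
    (EFin \o (fun y => (w y - w x) * bump_fun x r y)).
  apply: (@integrableS _ _ _ mu setT) => //; first exact: measurable_ball.
  exact: lcw.
(* As [w] is orthogonal to the bump, integrating [w y - w x] against it leaves minus [w x] times its
   mass: the value at [x] is controlled by the oscillation of [w] near [x]. *)
have e1 : w x * \int[mu]_y bump_fun x r y =
    - \int[mu]_(y in ball x r) ((w y - w x) * bump_fun x r y).
  have -> : \int[mu]_(y in ball x r) ((w y - w x) * bump_fun x r y) =
      \int[mu]_y (w y * bump_fun x r y - w x * bump_fun x r y).
    rewrite Rintegral_mkcond; apply: eq_Rintegral => y _; rewrite patchE.
    case: ifPn => [_|]; first by rewrite mulrBl.
    rewrite ball_itv notin_setE/= in_itv/= => /negP.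
    rewrite -ltr_distl -leNgt => yx.
    by rewrite bump_out ?(ger0_norm (ltW r0))// !mulr0 subrr.
  rewrite RintegralB//; [|exact: lcw|].
  - by rewrite (w0 _ (test_bump x r)) (RintegralZl (w x) measurableT lci) sub0r opprK.
  - by apply: lcw; apply: continuous_locally_integrable; exact: cst_continuous.
set I := \int[mu]_(y in ball x r) `|w y - w x|.
have e2 : `|\int[mu]_(y in ball x r) ((w y - w x) * bump_fun x r y)| <= r ^+ 4 * I.
  apply: (le_trans (le_normr_Rintegral _ iBphi)); first exact: measurable_ball.
  have iN := integrable_norm iB.
  rewrite -RintegralZl//; last exact: measurable_ball.
  apply: le_Rintegral; [exact: measurable_ball|exact: (integrable_norm iBphi)| |].
    by apply: (@integrableZl _ _ _ mu (ball x r) _ (r ^+ 4) _ iN); exact: measurable_ball.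
  move=> y _; rewrite normrM mulrC ler_wpM2r//.
  by have /andP[b0 b1] := bump_itv x y (ltW r0); rewrite ger0_norm.
(* On the concentric interval [D] of length [r] one has [(y - x) ^+ 2 <= r ^+ 2 / 4], hence the bump
   is at least [(3 / 4 * r ^+ 2) ^+ 2] there. *)
have e3 : 9 / 16 * r ^+ 5 <= \int[mu]_y bump_fun x r y.
  pose D : set R := `[x - r / 2, x + r / 2]%classic.
  have -> : 9 / 16 * r ^+ 5 = \int[mu]_(y in D) (9 / 16 * r ^+ 4).
    have muD : mu D = r%:E.
      rewrite /D lebesgue_measure_itv/= lte_fin ifT; last lra.
      by rewrite -EFinB; congr EFin; field.
    transitivity (9 / 16 * r ^+ 4 * fine (mu D)).
      by rewrite muD/=; ring.
    by rewrite Rintegral_cst//; exact: measurable_itv.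
  rewrite Rintegral_mkcond; apply: le_Rintegral => //.
    rewrite -restrict_EFin -integrable_mkcond; last exact: measurable_itv.
    by apply: locally_integrable_itv; apply: continuous_locally_integrable;
      exact: cst_continuous.
  move=> y _; rewrite patchE; case: ifPn => [|_]; last first.
    by have /andP[] := bump_itv x y (ltW r0).
  rewrite inE /D/= in_itv/= -ler_distl => yx.
  rewrite bump_inE ?(gtr0_norm r0); last lra.
  have : (y - x) ^+ 2 <= (r / 2) ^+ 2.
    by rewrite -(real_normK (num_real (y - x))) ler_sqr ?nnegrE//; lra.
  move=> h.
  have -> : 9 / 16 * r ^+ 4 = (3 / 4 * r ^+ 2) ^+ 2 by field.
  have r2 := sqr_ge0 r.
  by rewrite ler_sqr ?nnegrE; lra.
(* The average divides by the length [2 * r] of the ball, which turns [9 / 16 * r] into [9 / 32]. *)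
rewrite /davg /iavg lebesgue_measure_ball ?(ltW r0)// inver mulrn_eq0 (gt_eqF r0)/=.
have -> : (\int[mu]_(y in ball x r) `|(center (w x) \o w) y|%:E = I%:E)%E.
  rewrite /I/= fineK//.
  apply: integrable_fin_num => //; first exact: measurable_ball.
  exact: (integrable_norm iB).
rewrite lee_fin.
have : `|w x| * (9 / 16 * r ^+ 5) <= r ^+ 4 * I.
  apply: le_trans e2; rewrite -[leRHS]normrN -e1 normrM ler_wpM2l//.
  by apply: le_trans e3 _; exact: ler_norm.
have r4 : 0 < r ^+ 4 by rewrite exprn_gt0.
have -> : `|w x| * (9 / 16 * r ^+ 5) = r ^+ 4 * (`|w x| * (9 / 16 * r)) by ring.
rewrite ler_pM2l// => h.
rewrite [leRHS]mulrC ler_pdivlMr; last by rewrite pmulrn_lgt0.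
by rewrite -mulr_natr; move: h; lra.
Qed.

(** At a Lebesgue point the mean oscillation tends to 0 with the radius, while [weakly_zero_bound]
    keeps it above a multiple of [|w x|] that does not depend on the radius. *)
Lemma weakly_zero_ae w : locally_integrable setT w ->
  (forall phi, test_function phi -> \int[mu]_y (w y * phi y) = 0) ->
  {ae mu, forall x, w x = 0}.
Proof.
move=> lw w0; have := lebesgue_differentiation lw.
apply: (@filterS _ _ (ae_filter_ringOfSetsType mu)) => x wx.
have : ((9 / 32 * `|w x|)%:E <= 0)%E.
  apply: (cvge_to_ge wx); near=> r.
  have r0 : 0 < r by near: r; exact: nbhs_right_gt.
  exact: weakly_zero_bound.
rewrite lee_fin pmulr_rle0; last lra.
by rewrite normr_le0 => /eqP.
Unshelve. all: by end_near. Qed.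

End ScalarWeakDerivatives.

(** * Integrals of functions that agree almost everywhere *)

Section AeIntegral.
Local Open Scope ereal_scope.
Context {d} {T : measurableType d} {R : realType}.
Variable mu : {measure set T -> \bar R}.
Implicit Types f g : T -> \bar R.
Import HBNNSimple.

Lemma ge0_le_integral_ae f g : (forall x, 0 <= f x) -> (forall x, 0 <= g x) ->
  {ae mu, forall x, f x = g x} -> \int[mu]_x f x <= \int[mu]_x g x.
Proof.
move=> f0 g0 [N [mN N0 fgN]]; rewrite !ge0_integralTE//.
apply: ge_ereal_sup => _ /= [h hf <-]; apply: ereal_sup_ubound.
(* Off [N] the two functions agree, so [h] set to zero on [N] lies below [g]; its integral is still
   that of [h] because [N] is null. *)
exists (proj_nnsfun h (measurableC mN)) => [x|].
  rewrite -mrestrict patchE; case: ifPn => [xN|_]; last exact: g0.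
  have <- : f x = g x by apply: contrapT => /fgN; move: xN; rewrite inE.
  exact: hf.
transitivity (sintegral mu (h \_ (~` N))).
  by rewrite (mrestrict _ (measurableC mN)).
rewrite -integral_nnsfun; last exact: measurableC.
rewrite -setTD -ge0_negligible_integral//; first by rewrite integralT_nnsfun.
- by apply/measurable_EFinP; exact: measurable_funTS.
- by move=> x _; rewrite lee_fin fun_ge0.
Qed.

Lemma ge0_integral_ae f g : (forall x, 0 <= f x) -> (forall x, 0 <= g x) ->
  {ae mu, forall x, f x = g x} -> \int[mu]_x f x = \int[mu]_x g x.
Proof.
move=> f0 g0 fg; apply/eqP; rewrite eq_le !ge0_le_integral_ae//.
by apply: (@filterS _ _ (ae_filter_ringOfSetsType mu)) fg => x ->.
Qed.

(* No measurability is needed: a null set can be cut out of every simple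
   function in the supremum defining the integral. *)
Lemma integral_ae f g :
  {ae mu, forall x, f x = g x} -> \int[mu]_x f x = \int[mu]_x g x.
Proof.
move=> fg; have F := ae_filter_ringOfSetsType mu.
rewrite integralE [RHS]integralE; congr (_ - _); apply: ge0_integral_ae => //;
  by apply: filterS fg => x fgx; rewrite ?funeposE ?funenegE fgx.
Qed.

End AeIntegral.

(** * Weak derivatives of vector-valued functions and the chosen version [wderiv] *)

Section VectorWeakDerivatives.
Context {R : realType} {n : nat}.
Notation mu := (@lebesgue_measure R).
Implicit Types u v : R -> 'rV[R]_n.

Lemma ae_filter : Filter (almost_everywhere mu).
Proof. exact: ae_filter_ringOfSetsType. Qed.

Lemma ae_eq_fun_coord u v :
  (forall i, ae_eq_fun (fun x => u x ord0 i) (fun x => v x ord0 i)) ->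
  ae_eq_fun u v.
Proof.
move=> uv; have F := ae_filter.
have : \forall x \near almost_everywhere mu, forall i, u x ord0 i = v x ord0 i.
  exact: filter_forall.
by apply: filterS => x uvx; apply/rowP.
Qed.

Lemma ae_eq_fun_refl {T : Type} (u : R -> T) : ae_eq_fun u u.
Proof. exact: aeW. Qed.

Lemma ae_eq_fun_sym {T : Type} (u v : R -> T) : ae_eq_fun u v -> ae_eq_fun v u.
Proof. have F := ae_filter; by apply: filterS. Qed.

Lemma ae_eq_fun_trans {T : Type} (u v w : R -> T) :
  ae_eq_fun u v -> ae_eq_fun v w -> ae_eq_fun u w.
Proof.
have F := ae_filter; move=> uv; apply: filterS2 uv => x -> ->; by [].
Qed.

Lemma ae_eq_Rintegral (f g : R -> R) : ae_eq_fun f g ->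
  \int[mu]_x f x = \int[mu]_x g x.
Proof.
have F := ae_filter; move=> fg; congr fine; apply: integral_ae.
by apply: filterS fg => x ->.
Qed.

Definition coord_locint u :=
  forall i, locally_integrable setT (fun x => u x ord0 i).

Definition C1_pair u v :=
  forall i, C1_deriv (fun x => u x ord0 i) (fun x => v x ord0 i).

Lemma C1_pair_coord_locint u v :
  C1_pair u v -> coord_locint u /\ coord_locint v.
Proof.
move=> uv; split=> i; have [du cv] := uv i;
  apply: continuous_locally_integrable => //; exact: is_derive_continuous du.
Qed.

Lemma C1_pair_weak_deriv u v : C1_pair u v -> is_weak_deriv u v.
Proof.
move=> uv; have [lu lv] := C1_pair_coord_locint uv.
by split=> // phi tphi i; exact: integral_by_parts_test.
Qed.

(** The difference of two weak derivatives is orthogonal to all test functions in each coordinate.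
    This identifies, up to a null set, the version that [wderiv] selects. *)
Lemma weak_deriv_unique u v v' :
  is_weak_deriv u v -> is_weak_deriv u v' -> ae_eq_fun v v'.
Proof.
have F := ae_filter; move=> [lu lv uv] [_ lv' uv'].
apply: ae_eq_fun_coord => i.
have : {ae mu, forall x, v x ord0 i - v' x ord0 i = 0}.
  apply: (@weakly_zero_ae _ (fun x => v x ord0 i - v' x ord0 i)).
    exact: locally_integrableB.
  move=> phi tphi; have [/Ck_C1_deriv[dphi _] [M phi0]] := tphi.
  have cphi := is_derive_continuous dphi.
  under eq_Rintegral do rewrite mulrBl.
  rewrite RintegralB//; [|exact: (integrable_mul_support (lv i) cphi phi0)
    |exact: (integrable_mul_support (lv' i) cphi phi0)].
  by apply/eqP; rewrite subr_eq0 -eqr_opp -uv// -uv'.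
by apply: filterS => x /eqP; rewrite subr_eq0 => /eqP.
Qed.

Lemma weak_deriv_ae u u' v : ae_eq_fun u u' -> coord_locint u' ->
  is_weak_deriv u v -> is_weak_deriv u' v.
Proof.
have F := ae_filter; move=> uu' lu' [lu lv uv]; split=> // phi tphi i.
rewrite -uv//; apply: ae_eq_Rintegral; by apply: filterS uu' => x ->.
Qed.

Lemma wderivP u v : is_weak_deriv u v ->
  is_weak_deriv u (wderiv u) /\ ae_eq_fun (wderiv u) v.
Proof.
move=> uv; have wu : is_weak_deriv u (wderiv u) 
  by rewrite /wderiv; exact: (xgetPex _ (ex_intro _ v uv)).
by split=> //; exact: weak_deriv_unique wu uv.
Qed.

(** Both functions have the same set of weak derivatives, so the choice operator returns the same
    element of it. The result is an equality of functions and not merely almost everywhere; this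
    lets a derivative be replaced by a continuous version under an outer [wderiv]. *)
Lemma wderiv_ae u u' : ae_eq_fun u u' -> coord_locint u ->
  coord_locint u' -> wderiv u = wderiv u'.
Proof.
move=> uu' lu lu'; rewrite /wderiv; congr (xget _ _).
apply/seteqP; split=> v /=; apply: weak_deriv_ae => //.
exact: ae_eq_fun_sym.
Qed.

Lemma wderiv_C1 u v : C1_pair u v -> ae_eq_fun (wderiv u) v.
Proof. by move=> /C1_pair_weak_deriv /wderivP []. Qed.

Lemma wderiv_wderiv_C1 u v w : C1_pair u v -> C1_pair v w ->
  ae_eq_fun (wderiv (wderiv u)) w.
Proof.
move=> uv vw; have [wu /[dup] uv' h] := wderivP (C1_pair_weak_deriv uv).
rewrite (wderiv_ae uv') ; [exact: wderiv_C1| by case: wu|].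
exact: (C1_pair_coord_locint vw).1.
Qed.

End VectorWeakDerivatives.

(** * Square integrable functions *)

Section SquareIntegrable.
Context {R : realType} {n : nat}.
Notation mu := (@lebesgue_measure R).
Implicit Types u v : R -> 'rV[R]_n.

Lemma integrable_scale (k : R) (f : R -> R) : mu.-integrable setT (EFin \o f) ->
  mu.-integrable setT (EFin \o (fun x => k * f x)).
Proof. by move=> fi; exact: (integrableZl measurableT k fi). Qed.

Lemma integrable_add (f h : R -> R) : mu.-integrable setT (EFin \o f) ->
  mu.-integrable setT (EFin \o h) ->
  mu.-integrable setT (EFin \o (fun x => f x + h x)).
Proof. by move=> fi hi; exact: (integrableD measurableT fi hi). Qed.

Lemma oneDsqrV_integrable :
  mu.-integrable setT (EFin \o (fun x : R => (oneDsqr x)^-1)).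
Proof.
apply/integrableP; split.
  by apply/measurable_EFinP; apply: continuous_measurable_fun; exact: continuous_oneDsqrV.
under eq_integral do rewrite /= ger0_norm ?invr_ge0//.
rewrite ge0_symfun_integralT//=.
- by rewrite -set_itvcy integral0y_oneDsqr -EFinM ltry.
- exact: continuous_oneDsqrV.
- by move=> x; rewrite /= /oneDsqr sqrrN.
Qed.

Lemma Lfun2_of_integrable_sqr (f : R -> R) : measurable_fun setT f ->
  mu.-integrable setT (EFin \o (fun x => f x ^+ 2)) -> f \in Lfun mu 2%:E.
Proof.
move=> mf /integrableP[_ fi]; rewrite inE; apply/andP; split; rewrite inE//=.
rewrite /finite_norm unlock poweR_lty//; apply: le_lt_trans fi.
rewrite le_eqVlt; apply/orP; left; apply/eqP; apply: eq_integral => x _ /=.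
by rewrite powR_mulrn// normrX.
Qed.

Definition coord_measurable u := forall i, measurable_fun setT (fun x => u x ord0 i).

Lemma coord_locint_measurable u : coord_locint u -> coord_measurable u.
Proof. by move=> uL i; have [] := uL i. Qed.

Lemma L2_bounded u (G : R -> R) : coord_measurable u ->
  mu.-integrable setT (EFin \o G) ->
  (forall i x, (u x ord0 i) ^+ 2 <= G x) -> L2 u.
Proof.
move=> mu_ iG uG i; apply: Lfun2_of_integrable_sqr => //.
apply: le_integrable iG => //=.
  by apply/measurable_EFinP; apply: measurable_funX; exact: mu_.
move=> x _; rewrite lee_fin normrX real_normK ?num_real//.
by rewrite (le_trans (uG i x))// ler_norm.
Qed.

Lemma dot_integrable u v : L2 u -> L2 v ->
  mu.-integrable setT (EFin \o (fun x => dot (u x) (v x))).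
Proof.
move=> Lu Lv.
have -> : EFin \o (fun x => dot (u x) (v x)) =
  (fun x => \sum_(i < n) (u x ord0 i * v x ord0 i)%:E)%E.
  by apply/funext => x /=; rewrite sumEFin.
apply: integrable_sum => // i _.
have /Lfun1_integrable := Lfun2_mul_Lfun1 (Lu i) (Lv i); exact.
Qed.

Lemma dot_ge0 (a : 'rV[R]_n) : 0 <= dot a a.
Proof. by apply: sumr_ge0 => i _; rewrite -expr2 sqr_ge0. Qed.

Lemma L2dot_ge0 u : 0 <= L2dot u u.
Proof. by apply: Rintegral_ge0 => x _; exact: dot_ge0. Qed.

Lemma L2norm_sqr u : L2norm u ^+ 2 = L2dot u u.
Proof. by rewrite sqr_sqrtr// L2dot_ge0. Qed.

Lemma L2dot_ae u u' v v' : ae_eq_fun u u' -> ae_eq_fun v v' ->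
  L2dot u v = L2dot u' v'.
Proof.
have F := @ae_filter R; move=> uu' vv'; apply: ae_eq_Rintegral.
by apply: filterS2 uu' vv' => x -> ->.
Qed.

(** The discriminant argument behind Cauchy-Schwarz: [t = p / A] is the optimal choice. If [A = 0]
    and [p] is nonzero, [t = (C + 1) / (2 * p)] gives the contradiction [C + 1 <= C]. *)
Lemma quadratic_bound (A C p : R) : 0 <= A -> 0 <= C ->
  (forall t, 2 * t * p <= t ^+ 2 * A + C) -> p ^+ 2 <= A * C.
Proof.
move=> A0 C0 h; have [A00|A00] := eqVneq A 0.
  have [->|p0] := eqVneq p 0; first by rewrite expr0n mulr_ge0.
  have := h ((C + 1) / (2 * p)); rewrite A00 mulr0 add0r.
  have -> : 2 * ((C + 1) / (2 * p)) * p = C + 1 by field.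
  by rewrite gerDl ler10.
have := h (p / A).
have -> : 2 * (p / A) * p = 2 * (p ^+ 2 / A) by field.
have -> : (p / A) ^+ 2 * A = p ^+ 2 / A by field.
move=> h1; have : p ^+ 2 / A <= C by lra.
by rewrite ler_pdivrMr ?lt_neqAle ?A0 1?eq_sym ?A00// mulrC.
Qed.

Lemma L2dot_CauchySchwarz u v : L2 u -> L2 v ->
  `|L2dot u v| <= L2norm u * L2norm v.
Proof.
move=> Lu Lv; rewrite -ler_sqr ?nnegrE ?mulr_ge0 ?sqrtr_ge0//.
rewrite real_normK ?num_real// exprMn !L2norm_sqr.
apply: quadratic_bound; [exact: L2dot_ge0|exact: L2dot_ge0|move=> t].
have iuv := dot_integrable Lu Lv; have iuu := dot_integrable Lu Lu.
have ivv := dot_integrable Lv Lv.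
rewrite /L2dot -!RintegralZl// -RintegralD//; last exact: integrable_scale.
apply: le_Rintegral => //; first exact: integrable_scale.
  by apply: integrable_add => //; exact: integrable_scale.
move=> x _; rewrite -subr_ge0.
(* The quadratic inequality in [t] is the integral of the pointwise nonnegativity of the squared
   length of [t *: u x - v x]. *)
have -> : t ^+ 2 * dot (u x) (u x) + dot (v x) (v x) - 2 * t * dot (u x) (v x)
   = dot (t *: u x - v x) (t *: u x - v x).
  rewrite /dot !mulr_sumr -big_split -sumrB; apply: eq_bigr => i _.
  by rewrite !mxE/=; ring.
exact: dot_ge0.
Qed.

Lemma L2norm_bounded u (B : R) (G : R -> R) : 0 <= B -> coord_measurable u ->
  mu.-integrable setT (EFin \o G) ->
  (forall i x, (u x ord0 i) ^+ 2 <= B ^+ 2 * G x) ->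
  L2norm u <= B * Num.sqrt (n%:R * \int[mu]_x G x).
Proof.
move=> B0 mu_ iG uG.
rewrite -[B in B * _]ger0_norm// -sqrtr_sqr -sqrtrM ?sqr_ge0//.
rewrite ler_wsqrtr// /L2dot mulrA.
have iBG : mu.-integrable setT (EFin \o (fun x => B ^+ 2 * G x)).
  exact: integrable_scale.
have Lu : L2 u by exact: L2_bounded iBG uG.
rewrite -RintegralZl//; apply: le_Rintegral => //.
- exact: dot_integrable.
- exact: integrable_scale.
- move=> x _; rewrite /dot.
  have -> : B ^+ 2 * n%:R * G x = \sum_(i < n) (B ^+ 2 * G x).
    by rewrite sumr_const card_ord -mulr_natl; ring.
  by apply: ler_sum => i _; rewrite -expr2.
Qed.

End SquareIntegrable.

(** * Differentiability and Lipschitz bounds in R^n *)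

Section Norms.
Context {R : realType} {n : nat}.
Implicit Types a b : 'rV[R]_n.

Lemma rV_norm_coord a i : `|a ord0 i| <= `|a|.
Proof.
by rewrite [leRHS]/Num.Def.normr/= mx_normrE; exact: (le_bigmax _ _ (ord0, i)).
Qed.

Lemma rV_norm_le a B : 0 <= B -> (forall i, `|a ord0 i| <= B) -> `|a| <= B.
Proof.
move=> B0 aB; rewrite /Num.Def.normr/= mx_normrE (bigmax_le _ B0)//= => -[i j] _.
by rewrite ord1 aB.
Qed.

Lemma enorm_coord a i : `|a ord0 i| <= enorm a.
Proof.
rewrite -ler_sqr ?nnegrE ?sqrtr_ge0// sqr_sqrtr ?dot_ge0// real_normK ?num_real//.
rewrite /dot (bigD1 i)//= -expr2 lerDl sumr_ge0// => j _.
by rewrite -expr2 sqr_ge0.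
Qed.

Lemma norm_le_enorm a : `|a| <= enorm a.
Proof. by apply: rV_norm_le; [exact: sqrtr_ge0|exact: enorm_coord]. Qed.

End Norms.

Section CkVector.
Context {R : realType} {n : nat}.
Implicit Types u : R -> 'rV[R]_n.

Lemma continuous_coord u i : continuous u -> continuous (fun x => u x ord0 i).
Proof.
move=> cu x; apply: (@continuous_comp _ _ _ u (fun a : 'rV[R]_n => a ord0 i)).
  exact: cu.
exact: coord_continuous.
Qed.

Lemma derivable_coord u (x : R) i : derivable u x 1 ->
  is_derive x 1 (fun y => u y ord0 i) (derive1 u x ord0 i).
Proof.
move=> du; rewrite derive1E derive_mx// mxE; apply/derivableP.
exact: (derivable_mxP u x 1).1.
Qed.

Lemma Ck1_C1_pair u : Ck 1 u -> C1_pair u (derive1 u).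
Proof.
move=> [du cu] i; split=> [x|].
  by apply: derivable_coord; apply/derivable1_diffP; exact: du.
apply: continuous_coord.
have -> : derive1 u = (fun x => 'D_1 u x) by apply/funext => x; rewrite derive1E.
exact: cu.
Qed.

Lemma Ck2_Ck1 u : Ck 2 u -> Ck 1 u /\ Ck 1 (derive1 u).
Proof.
move=> [du cu]; have e : derive1 u = (fun x => 'D_1 u x).
  by apply/funext => x; rewrite derive1E.
split; last by rewrite e; exact: cu.
split=> // v x; have [dv _] := cu v.
by apply: differentiable_continuous.
Qed.

End CkVector.

Section Lipschitz.
Context {R : realType} {n : nat}.
Implicit Types f : 'rV[R]_n -> 'rV[R]_n.

Lemma closed_ball_compact (B : R) : compact [set a : 'rV[R]_n | `|a| <= B].
Proof.
apply: bounded_closed_compact.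
  exists B; split; first exact: num_real.
  by move=> M BM a /= aB; rewrite (le_trans aB)// ltW.
apply: (@closed_comp _ _ (fun a : 'rV[R]_n => `|a|) [set x | x <= B]).
  by move=> a _; exact: norm_continuous.
exact: closed_le.
Qed.

Lemma partial_bounded f (B : R) : Ck 1 f ->
  exists2 L : R, 0 <= L & forall (a : 'rV[R]_n) i j, `|a| <= B ->
    `|'D_(delta_mx 0 j) f a ord0 i| <= L.
Proof.
move=> [df cf].
have H j : exists2 L : R, 0 <= L & forall a : 'rV[R]_n, `|a| <= B ->
    `|'D_(delta_mx 0 j) f a| <= L.
  have /compact_bounded[L [_ LM]] :
      compact ((fun a => 'D_(delta_mx 0 j) f a) @` [set a : 'rV[R]_n | `|a| <= B]).
    apply: continuous_compact; last exact: closed_ball_compact.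
    exact/continuous_subspaceT/cf.
  exists (`|L| + 1); first by rewrite addr_ge0.
  move=> a aB; apply: (LM (`|L| + 1)).
    by rewrite (le_lt_trans (ler_norm L))// ltrDl.
  by exists a.
pose L j := sval (cid2 (H j)).
have L0 j : 0 <= L j by rewrite /L; case: cid2.
exists (\sum_j L j); first exact: sumr_ge0.
move=> a i j aB; apply: le_trans (rV_norm_coord _ _) _.
rewrite (bigD1 j)//= (le_trans _ (_ : L j <= _))//; last first.
  by rewrite lerDl sumr_ge0.
by rewrite /L; case: cid2 => /= x x0; exact.
Qed.

(** The mean value theorem on the segment from [b] to [a], which stays in the ball by convexity. It
    is applied to one coordinate at a time since it fails for vector values; the [n] partial
    derivatives, each at most [L] in size, add up to the constant [n * L]. *)
Lemma Ck1_lipschitz f (B : R) : Ck 1 f ->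
  exists2 L : R, 0 <= L & forall a b : 'rV[R]_n, `|a| <= B -> `|b| <= B ->
    forall i, `|f a ord0 i - f b ord0 i| <= L * `|a - b|.
Proof.
move=> fC; have [L L0 LB] := partial_bounded B fC.
exists (n%:R * L); first by rewrite mulr_ge0.
move=> a b aB bB i; have [df _] := fC.
pose p (t : R) : 'rV[R]_n := b + t *: (a - b).
have dh (t : R) : is_derive t 1 (fun t => f (p t) ord0 i)
    (('D_(a - b) f (p t)) ord0 i).
  have dp : is_diff t p (fun s => s *: (a - b)).
    have := is_diffD (is_diff_cst b t) (is_diff_scalel t (a - b)).
    by rewrite add0r.
  have dfp : differentiable (f \o p) t by exact: differentiable_comp.
  have -> : 'D_(a - b) f (p t) = derive1 (f \o p) t.
    have dpt : 'd p t 1 = a - b by rewrite (@diff_val _ _ _ _ _ _ _ dp) scale1r.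
    have dft : differentiable f (p t) by exact: df.
    have dpt' : differentiable p t by [].
    rewrite derive1E (deriveE _ dfp) (deriveE _ dft).
    by rewrite (diff_comp dpt' dft) /= dpt.
  by apply: derivable_coord; exact/derivable1_diffP.
have [c c01] := @MVT_segment R (fun t => f (p t) ord0 i) _ 0 1 ler01
  (fun x _ => dh x) (continuous_subspaceT (is_derive_continuous dh)).
have -> : p 1 = a by rewrite /p scale1r addrC subrK.
have -> : p 0 = b by rewrite /p scale0r addr0.
rewrite subr0 mulr1 => ->.
have cB : `|p c| <= B.
  have -> : p c = (1 - c) *: b + c *: a.
    by rewrite /p scalerBr scalerBl scale1r addrA addrAC.
  have /andP[c0 c1] : 0 <= c <= 1 by move: c01; rewrite in_itv.
  apply: le_trans (ler_normD _ _) _; rewrite !normrZ (ger0_norm c0) ger0_norm ?subr_ge0//.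
  have h1 : (1 - c) * `|b| <= (1 - c) * B by rewrite ler_wpM2l ?subr_ge0.
  have h2 : c * `|a| <= c * B by rewrite ler_wpM2l.
  lra.
rewrite deriveEjacobian// mxE.
apply: le_trans (ler_norm_sum _ _ _) _.
rewrite -mulrA -[X in X%:R * _]card_ord mulr_natl -sumr_const; apply: ler_sum => j _.
rewrite normrM mulrC ler_pM//; last exact: rV_norm_coord.
have := LB (p c) i j cB; rewrite deriveEjacobian// mxE (bigD1 j)//= big1 ?addr0.
  by rewrite mxE !eqxx mul1r.
by move=> k kj; rewrite mxE (negbTE kj) andbF mul0r.
Qed.

End Lipschitz.

(** * Decay and dilation of the wave profile *)

Section Weight.
Context {R : realType}.

(** One even weight replaces the exponentials with their two different rates. It is integrable, and
    its product with [1 + |x|] is still square integrable, which leaves room for the factor [|x|]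
    that differentiating a dilation in its parameter produces. *)
Definition weight (x : R) : R := (oneDsqr x)^-1.

Lemma weight_ge0 x : 0 <= weight x.
Proof. by rewrite invr_ge0 (le_trans ler01)// oneDsqr_ge1. Qed.

Lemma weight_le1 x : weight x <= 1.
Proof. exact: oneDsqrV_le1. Qed.

Lemma le_weight (x y : R) : `|x| <= `|y| -> weight y <= weight x.
Proof.
move=> xy; rewrite /weight lef_pV2 ?posrE ?(lt_le_trans ltr01 (oneDsqr_ge1 _))//.
by rewrite /oneDsqr lerD2l ler_sqr_norm.
Qed.

Lemma weight_linear (x : R) : ((1 + `|x|) * weight x) ^+ 2 <= 2 * weight x.
Proof.
have p : 0 < oneDsqr x by rewrite (lt_le_trans ltr01 (oneDsqr_ge1 _)).
have k0 := weight_ge0 x; have k1 : oneDsqr x * weight x = 1.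
  by rewrite /weight divff// gt_eqF.
have e : (1 + `|x|) ^+ 2 <= 2 * oneDsqr x.
  have := sqr_ge0 (1 - `|x|); rewrite /oneDsqr -(real_normK (num_real x)); lra.
rewrite exprMn (expr2 (weight x)) mulrA ler_wpM2r//.
by rewrite (le_trans (ler_wpM2r k0 e))// -mulrA k1 mulr1.
Qed.

Lemma expR_le_weight (nu : R) : 0 < nu ->
  exists2 C : R, 0 <= C & forall x, expR (- nu * `|x|) <= C * weight x.
Proof.
(* With [y = nu * |x|], squaring [1 + y / 2 <= expR (y / 2)] gives [1 + y ^+ 2 / 4 <= expR y], and
   [1 + x ^+ 2 = 1 + (4 / nu ^+ 2) * (y ^+ 2 / 4)]. *)
move=> nu0; exists (1 + 4 / nu ^+ 2).
  by rewrite addr_ge0// divr_ge0// sqr_ge0.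
move=> x; have p : 0 < oneDsqr x by rewrite (lt_le_trans ltr01 (oneDsqr_ge1 _)).
rewrite /weight ler_pdivlMr//.
rewrite mulNr expRN -ler_pdivlMl ?invr_gt0 ?expR_gt0// invrK.
set y := nu * `|x|.
have y0 : 0 <= y by rewrite mulr_ge0// ltW.
have h : 1 + y ^+ 2 / 4 <= expR y.
  have -> : y = y / 2 + y / 2 by field.
  rewrite expRD; have h1 := expR_ge1Dx (y / 2).
  have h2 : (1 + y / 2) * (1 + y / 2) <= expR (y / 2) * expR (y / 2).
    by rewrite ler_pM//; lra.
  apply: le_trans h2; nra.
have q : 0 <= 4 / nu ^+ 2 by rewrite divr_ge0// sqr_ge0.
have e : oneDsqr x = 1 + (4 / nu ^+ 2) * (y ^+ 2 / 4).
  rewrite /y exprMn real_normK ?num_real// /oneDsqr; field; exact: lt0r_neq0.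
rewrite e mulrC.
have := sqr_ge0 y; nra.
Qed.

(** Since [1 <= a], the point [a * x] lies on the same side of 0 as [x] and no closer to it. The
    intermediate point of the mean value theorem is thus at least as far from 0 as [x], where the
    weight is no larger than [weight x]. *)
Lemma scaling_bound (G G' : R -> R) (M a : R) :
  (forall x : R, is_derive x 1 G (G' x)) ->
  (forall x, `|G' x| <= M * weight x) -> 0 <= M -> 1 <= a ->
  forall x, `|G (a * x) - G x| <= M * (a - 1) * (`|x| * weight x).
Proof.
move=> dG G'M M0 a1 x.
have cG := is_derive_continuous dG.
have key c : `|x| <= `|c| -> `|G' c * (a * x - x)| <= M * (a - 1) * (`|x| * weight x).
  move=> xc; rewrite normrM (_ : a * x - x = (a - 1) * x); last by ring.
  rewrite [leRHS](_ : _ = (M * weight x) * ((a - 1) * `|x|)); last by ring.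
  rewrite normrM (ger0_norm (_ : 0 <= a - 1)) ?subr_ge0// ler_wpM2r ?mulr_ge0 ?subr_ge0//.
  by rewrite (le_trans (G'M c))// ler_wpM2l// le_weight.
have [x0|/ltW x0] := leP 0 x.
  have xax : x <= a * x by rewrite ler_peMl.
  have [c cI ->] := MVT_segment xax (fun y _ => dG y) (continuous_subspaceT cG).
  apply: key; move: cI; rewrite in_itv/= => /andP[xc _].
  by rewrite !ger0_norm// (le_trans x0).
have xax : a * x <= x by rewrite ler_neMl.
have [c cI] := MVT_segment xax (fun y _ => dG y) (continuous_subspaceT cG).
move=> e; rewrite distrC e -normrN -mulrN opprB.
apply: key; move: cI; rewrite in_itv/= => /andP[_ xc].
by rewrite !ler0_norm ?lerN2// (le_trans xc).
Qed.

End Weight.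

Section C1Pairs.
Context {R : realType} {n : nat}.
Implicit Types (u v : R -> 'rV[R]_n) (a k : R).

Lemma derive1_rowE u (x : R) (w : 'rV[R]_n) :
  (forall i, is_derive x 1 (fun y => u y ord0 i) (w ord0 i)) -> derive1 u x = w.
Proof.
move=> du; have dux : derivable u x 1.
  by apply/derivable_mxP => i j; rewrite ord1; have [] := du j.
apply/rowP => i; have [_ <-] := derivable_coord i dux.
by have [_ <-] := du i.
Qed.

Lemma C1_pair_dilate u v a : C1_pair u v ->
  C1_pair (fun x => u (a * x)) (fun x => a *: v (a * x)).
Proof.
move=> uv i; have [du cv] := uv i; split=> [x|].
  rewrite mxE mulrC.
  have da : is_derive x 1 (fun y : R => a * y) a.
    by apply: is_derive_eq; rewrite /GRing.scale/= mulr1.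
  exact: (@is_derive1_comp _ (fun y => u y ord0 i) (fun y => a * y) _ _ _ (du _) da).
have -> : (fun x => (a *: v (a * x)) ord0 i) = (fun x => a * v (a * x) ord0 i).
  by apply/funext => x; rewrite mxE.
move=> x; apply: cvgM; first exact: cvg_cst.
apply: (@continuous_comp _ _ _ (fun y : R => a * y) (fun y => v y ord0 i)).
  by apply: cvgM; [exact: cvg_cst|exact: cvg_id].
exact: cv.
Qed.

Lemma C1_pair_scale u v k : C1_pair u v ->
  C1_pair (fun x => k *: u x) (fun x => k *: v x).
Proof.
move=> uv i; have [du cv] := uv i.
have e (w : R -> 'rV[R]_n) :
    (fun x => (k *: w x) ord0 i) = (fun x => k * w x ord0 i).
  by apply/funext => x; rewrite mxE.
rewrite !e; split=> x.
  by have := is_deriveZ k (du x).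
by apply: cvgM; [exact: cvg_cst|exact: cv].
Qed.

Lemma C1_pair_sub u v u' v' : C1_pair u v -> C1_pair u' v' ->
  C1_pair (fun x => u x - u' x) (fun x => v x - v' x).
Proof.
move=> uv uv' i; have [du cv] := uv i; have [du' cv'] := uv' i.
have e (w w' : R -> 'rV[R]_n) :
    (fun x => (w x - w' x) ord0 i) = (fun x => w x ord0 i - w' x ord0 i).
  by apply/funext => x; rewrite !mxE.
rewrite !e; split=> x.
  by have := is_deriveB (du x) (du' x).
by apply: cvgB; [exact: cv|exact: cv'].
Qed.

End C1Pairs.

Lemma affine_dist {R : realType} (r c p q p' q' : R) :
  `|r * (c * p + q) - r * (c * p' + q')| <=
  `|r| * (`|c| * `|p - p'| + `|q - q'|).
Proof.
rewrite -mulrBr normrM ler_wpM2l// -normrM.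
rewrite (_ : _ - _ = c * (p - p') + (q - q')); last by ring.
exact: ler_normD.
Qed.

(** Each difference splits into a prefactor change, [a - 1] or [a ^+ 2 - 1] times a decaying
    function, and an increment under dilation. As [a - 1 <= a ^+ 2 - 1], all are measured by
    [a ^+ 2 - 1]. *)
Lemma dilation_bounds {R : realType} {n : nat} (rho c0 M L : R)
    (f : 'rV[R]_n -> 'rV[R]_n) (P P1 P2 : R -> 'rV[R]_n) :
  0 < rho -> 0 <= M -> 0 <= L -> C1_pair P P1 -> C1_pair P1 P2 ->
  (forall x i, P2 x ord0 i = - rho^-1 * (c0 * P1 x ord0 i + f (P x) ord0 i)) ->
  (forall x i, `|P1 x ord0 i| <= M * weight x) ->
  (forall x i, `|P2 x ord0 i| <= M * weight x) ->
  (forall x y i, `|f (P x) ord0 i - f (P y) ord0 i| <= L * `|P x - P y|) ->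
  exists2 C : R, 0 <= C & forall a, 1 <= a -> forall x i, [/\
    `|(P (a * x) - P x) ord0 i| <= C * (a ^+ 2 - 1) * ((1 + `|x|) * weight x),
    `|(a *: P1 (a * x) - P1 x) ord0 i| <=
       C * (a ^+ 2 - 1) * ((1 + `|x|) * weight x) &
    `|(a *: (a *: P2 (a * x)) - P2 x) ord0 i| <=
       C * (a ^+ 2 - 1) * ((1 + `|x|) * weight x)].
Proof.
move=> rho0 M0 L0 C1 C2 ode M1 M2 lip.
pose N := rho^-1 * (`|c0| * M + L * M).
have N0 : 0 <= N.
  by rewrite mulr_ge0 ?invr_ge0 ?(ltW rho0)// addr_ge0// mulr_ge0.
exists (M + N); first by rewrite addr_ge0.
move=> a a1 x i.
have w0 := weight_ge0 x.
have wa : weight (a * x) <= weight x.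
  by apply: le_weight; rewrite normrM ler_peMl// ger0_norm// (le_trans ler01).
set W := (1 + `|x|) * weight x.
have xw0 : 0 <= `|x| * weight x by rewrite mulr_ge0.
have We : W = weight x + `|x| * weight x by rewrite /W mulrDl mul1r.
set s := a ^+ 2 - 1.
have as1 : a - 1 <= s by rewrite /s; nra.
have a0 : 0 <= a - 1 by rewrite subr_ge0.
have s0 : 0 <= s by lra.
have B0 j : `|P (a * x) ord0 j - P x ord0 j| <= M * (a - 1) * (`|x| * weight x).
  exact: (scaling_bound (C1 j).1 (M1^~ j)).
have B1 : `|P1 (a * x) ord0 i - P1 x ord0 i| <= M * (a - 1) * (`|x| * weight x).
  exact: (scaling_bound (C2 i).1 (M2^~ i)).
have B2 : `|P2 (a * x) ord0 i - P2 x ord0 i| <= N * (a - 1) * (`|x| * weight x).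
  rewrite (ode (a * x)) (ode x); apply: le_trans (affine_dist _ _ _ _ _ _) _.
  rewrite /N normrN gtr0_norm ?invr_gt0// -2!mulrA.
  rewrite ler_wpM2l ?invr_ge0 ?(ltW rho0)// mulrDl lerD//.
    by rewrite -mulrA ler_wpM2l// mulrA.
  rewrite (le_trans (lip _ _ _))// -mulrA ler_wpM2l// mulrA.
  apply: rV_norm_le => [|j]; first by rewrite !mulr_ge0.
  by rewrite !mxE B0.
have MW : M * s * W <= (M + N) * s * W.
  by rewrite ler_wpM2r ?We ?addr_ge0// ler_wpM2r// lerDl.
have H1 k : 0 <= k -> k * (a - 1) * (`|x| * weight x) <= k * s * (`|x| * weight x).
  by move=> k0; rewrite ler_wpM2r// ler_wpM2l.
split.
- rewrite !mxE; apply: le_trans (B0 i) _; apply: le_trans (H1 _ M0) _.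
  by apply: le_trans MW; rewrite ler_wpM2l ?mulr_ge0// We lerDr.
- rewrite !mxE; apply: le_trans MW.
  move: B1 (M1 (a * x) i).
  move: (P1 (a * x) ord0 i) (P1 x ord0 i) => p q B1 Mp.
  rewrite (_ : a * p - q = (a - 1) * p + (p - q)); last by ring.
  apply: le_trans (ler_normD _ _) _; rewrite We mulrDr lerD//; last first.
    by apply: le_trans B1 _; exact: H1.
  rewrite normrM (ger0_norm a0) (_ : M * s * weight x = s * (M * weight x)); last by ring.
  rewrite ler_pM//; apply: le_trans Mp _.
  by rewrite ler_wpM2l.
- rewrite !mxE.
  move: B2 (M2 (a * x) i).
  move: (P2 (a * x) ord0 i) (P2 x ord0 i) => p q B2 Mp.
  rewrite (_ : a * (a * p) - q = s * p + (p - q)); last by rewrite /s; ring.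
  have -> : (M + N) * s * W = M * s * W + N * s * W by ring.
  apply: le_trans (ler_normD _ _) _; rewrite lerD//; last first.
    apply: le_trans B2 _; apply: le_trans (H1 _ N0) _.
    by rewrite ler_wpM2l ?(mulr_ge0 N0 s0)// We lerDr.
  rewrite normrM (ger0_norm s0) (_ : M * s * W = s * (M * W)); last by ring.
  rewrite ler_wpM2l//; apply: le_trans Mp _.
  by rewrite ler_wpM2l// We (le_trans wa)// lerDl.
Qed.

(** * Decay of the profile and of its derivatives *)

Section WaveProfile.
Context {R : realType} {n : nat}.
Variables (rho c0 : R) (f : 'rV[R]_n -> 'rV[R]_n) (um up : 'rV[R]_n)
  (Phi : R -> 'rV[R]_n).

Notation Phi' := (derive1 Phi).
Notation Phi'' := (derive1 (derive1 Phi)).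

Lemma wave_profile_ODE : Ck 1 Phi -> solves_RDE rho f (fun x t => Phi (x - c0 * t)) ->
  forall x, - (c0 *: Phi' x) = rho *: Phi'' x + f (Phi x).
Proof.
move=> CPhi /[swap] x /(_ x 0).
have -> : (fun z => Phi (z - c0 * 0)) = Phi.
  by apply/funext => z; rewrite mulr0 subr0.
rewrite mulr0 subr0 => <-; symmetry; apply: derive1_rowE => i.
have [dPhi _] := Ck1_C1_pair CPhi i.
have da : is_derive (0 : R) 1 (fun s : R => x - c0 * s) (- c0).
  apply: is_derive_eq; rewrite /GRing.scale/=. ring.
have := @is_derive1_comp _ (fun y => Phi y ord0 i) (fun s => x - c0 * s)
  0 _ _ (dPhi _) da.
by rewrite !mxE mulr0 subr0 mulrN mulrC.
Qed.

Lemma wave_profile_ODE_coord : 0 < rho -> Ck 1 Phi ->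
  solves_RDE rho f (fun x t => Phi (x - c0 * t)) -> forall x i,
  Phi'' x ord0 i = - rho^-1 * (c0 * Phi' x ord0 i + f (Phi x) ord0 i).
Proof.
move=> rho0 CPhi rde x i; have /rowP/(_ i) := wave_profile_ODE CPhi rde x.
rewrite !mxE; set p := Phi' x _ _; set q := Phi'' x _ _ => e.
have -> : c0 * p = - (rho * q + f (Phi x) ord0 i) by lra.
by field; rewrite gt_eqF.
Qed.

(** The decay of [Phi''] is not assumed: in the wave equation [f (Phi x)] equals [f (Phi x) - f z]
    for the end state [z] on the side of [x], and is therefore Lipschitz-controlled by
    [Phi x - z]. *)
Lemma wave_profile_bounds : 0 < rho -> Ck 1 f -> f um = 0 -> f up = 0 ->
  wave_assumption rho f um up Phi c0 ->
  exists M L : R, [/\ 0 <= M, 0 <= L,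
    forall x i, `|Phi' x ord0 i| <= M * weight x,
    forall x i, `|Phi'' x ord0 i| <= M * weight x &
    forall x y i, `|f (Phi x) ord0 i - f (Phi y) ord0 i| <= L * `|Phi x - Phi y| ].
Proof.
move=> rho0 Cf fum fup [CPhi rde [K' [num [nup [K0 num0 nup0 decm decp]]]]].
have [Cm Cm0 wm] := expR_le_weight num0.
have [Cp Cp0 wp] := expR_le_weight nup0.
have ode := wave_profile_ODE_coord rho0 (Ck2_Ck1 CPhi).1 rde.
pose D := K' * (Cm + Cp).
have D0 : 0 <= D by rewrite mulr_ge0 ?addr_ge0// ltW.
have enorm_ge0 (a : 'rV[R]_n) : 0 <= enorm a by exact: sqrtr_ge0.
have dec x : exists2 z, f z = 0 /\ `|z| <= `|um| + `|up| &
    `|Phi x - z| <= D * weight x /\ `|Phi' x| <= D * weight x.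
  have w0 := weight_ge0 x.
  have [x0|/ltW x0] := leP x 0.
    exists um; first by rewrite fum lerDl.
    have h1 : K' * expR (- num * `|x|) <= D * weight x.
      rewrite /D -mulrA (ler_wpM2l (ltW K0))// (le_trans (wm x))// ler_wpM2r//.
      by rewrite lerDl.
    have := decm x x0; have := norm_le_enorm (Phi x - um).
    have := norm_le_enorm (Phi' x).
    have := enorm_ge0 (Phi x - um); have := enorm_ge0 (Phi' x).
    by move: h1; split; lra.
  exists up; first by rewrite fup lerDr.
  have h1 : K' * expR (- nup * `|x|) <= D * weight x.
    rewrite /D -mulrA (ler_wpM2l (ltW K0))// (le_trans (wp x))// ler_wpM2r//.
    by rewrite lerDr.
  have := decp x x0; have := norm_le_enorm (Phi x - up).
  have := norm_le_enorm (Phi' x).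
  have := enorm_ge0 (Phi x - up); have := enorm_ge0 (Phi' x).
  by move: h1; split; lra.
(* A ball containing the whole profile and both end states, since a Lipschitz constant of [f] is
   available only on bounded sets. *)
pose B := `|um| + `|up| + D.
have PhiB x : `|Phi x| <= B.
  have [z [_ zB] [h _]] := dec x.
  have := ler_normD (Phi x - z) z; rewrite subrK.
  have : D * weight x <= D by rewrite ler_piMr// weight_le1.
  rewrite /B; lra.
have [L L0 lipf] := Ck1_lipschitz B Cf.
exists (D + rho^-1 * (`|c0| * D + L * D)), L.
have E0 : 0 <= rho^-1 * (`|c0| * D + L * D).
  by rewrite mulr_ge0 ?invr_ge0 ?(ltW rho0)// addr_ge0// mulr_ge0.
split=> //; first by rewrite addr_ge0.
- move=> x i; have [z _ [_ h]] := dec x.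
  apply: le_trans (rV_norm_coord _ _) (le_trans h _).
  by rewrite ler_wpM2r ?weight_ge0// lerDl.
- move=> x i; have [z [fz zB] [hz h]] := dec x.
  have w0 := weight_ge0 x.
  rewrite ode normrM normrN (gtr0_norm (_ : 0 < rho^-1)) ?invr_gt0//.
  rewrite mulrDl.
  rewrite (le_trans _ (_ : rho^-1 * (`|c0| * D + L * D) * weight x <= _))//;
    last first.
    by rewrite lerDr mulr_ge0.
  rewrite -mulrA ler_wpM2l ?invr_ge0 ?(ltW rho0)// mulrDl.
  rewrite (le_trans (ler_normD _ _))// lerD//.
    rewrite normrM -mulrA ler_wpM2l//.
    exact: le_trans (rV_norm_coord _ _) h.
  have := lipf (Phi x) z (PhiB x) _ i; rewrite fz mxE subr0 => h2.
  rewrite (le_trans (h2 _))//; last by rewrite -mulrA ler_wpM2l.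
  by rewrite (le_trans zB)// lerDl.
- by move=> x y i; exact: lipf.
Qed.

Lemma dilated_wave_bounds : 0 < rho -> Ck 1 f -> f um = 0 -> f up = 0 ->
  wave_assumption rho f um up Phi c0 ->
  exists2 C : R, 0 <= C & forall a, 1 <= a -> forall x i, [/\
    `|(Phi (a * x) - Phi x) ord0 i| <= C * (a ^+ 2 - 1) * ((1 + `|x|) * weight x),
    `|(a *: Phi' (a * x) - Phi' x) ord0 i| <=
       C * (a ^+ 2 - 1) * ((1 + `|x|) * weight x) &
    `|(a *: (a *: Phi'' (a * x)) - Phi'' x) ord0 i| <=
       C * (a ^+ 2 - 1) * ((1 + `|x|) * weight x)].
Proof.
move=> rho0 Cf fum fup hw; have [CPhi rde _] := hw.
have [M [L [M0 L0 M1 M2 lip]]] := wave_profile_bounds rho0 Cf fum fup hw.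
have [C1 C2] := Ck2_Ck1 CPhi.
have ode := wave_profile_ODE_coord rho0 C1 rde.
exact: (dilation_bounds rho0 M0 L0 (Ck1_C1_pair C1) (Ck1_C1_pair C2) ode M1 M2 lip).
Qed.

End WaveProfile.

(** * L^2 and H^2 bounds by domination *)

Section Dominated.
Context {R : realType} {n : nat}.
Notation mu := (@lebesgue_measure R).
Implicit Types (u v w : R -> 'rV[R]_n).

(** By [weight_linear], an upper bound for the L^2 norm of the field all of whose [n] coordinates
    equal [1 + |x|] times [weight x]. *)
Definition weight_norm : R := Num.sqrt (n%:R * \int[mu]_x (2 * weight x)).

Lemma L2_dominated u (B : R) : 0 <= B -> coord_measurable u ->
  (forall x i, `|u x ord0 i| <= B * ((1 + `|x|) * weight x)) ->
  L2 u /\ L2norm u <= B * weight_norm.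
Proof.
move=> B0 mu_ uB.
have iw : mu.-integrable setT (EFin \o (fun x => 2 * weight x)).
  by apply: integrable_scale; exact: oneDsqrV_integrable.
have uG i x : (u x ord0 i) ^+ 2 <= B ^+ 2 * (2 * weight x).
  apply: (@le_trans _ _ (B ^+ 2 * ((1 + `|x|) * weight x) ^+ 2)); last first.
    by rewrite ler_wpM2l ?sqr_ge0// weight_linear.
  rewrite -exprMn -real_normK ?num_real// ler_sqr ?nnegrE//.
  by rewrite !mulr_ge0 ?addr_ge0// weight_ge0.
split; last exact: L2norm_bounded iw uG.
exact: L2_bounded mu_ (integrable_scale _ iw) uG.
Qed.

Lemma L2norm_ae u v : ae_eq_fun u v -> L2norm u = L2norm v.
Proof. by move=> uv; rewrite /L2norm (L2dot_ae uv uv). Qed.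

Lemma C1_pair_measurable u v : C1_pair u v -> coord_measurable u /\ coord_measurable v.
Proof.
by move=> /C1_pair_coord_locint[lu lv]; split; exact: coord_locint_measurable.
Qed.

Lemma Hk2_dominated u v w (B : R) : 0 <= B -> C1_pair u v -> C1_pair v w ->
  (forall x i, [/\ `|u x ord0 i| <= B * ((1 + `|x|) * weight x),
    `|v x ord0 i| <= B * ((1 + `|x|) * weight x) &
    `|w x ord0 i| <= B * ((1 + `|x|) * weight x)]) ->
  Hk 2 u /\ Hknorm 2 u <= 2 * (B * weight_norm).
Proof.
move=> B0 uv vw uB.
have [mu_ mv] := C1_pair_measurable uv; have [_ mw] := C1_pair_measurable vw.
have [Lu uN] : L2 u /\ L2norm u <= B * weight_norm.
  by apply: L2_dominated => // x i; have [] := uB x i.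
have [Lv vN] : L2 v /\ L2norm v <= B * weight_norm.
  by apply: L2_dominated => // x i; have [] := uB x i.
have [Lw wN] : L2 w /\ L2norm w <= B * weight_norm.
  by apply: L2_dominated => // x i; have [] := uB x i.
split.
  split=> //; exists v; first exact: C1_pair_weak_deriv.
  by split=> //; exists w; first exact: C1_pair_weak_deriv.
have [wu uv'] := wderivP (C1_pair_weak_deriv uv).
have lv := (C1_pair_coord_locint vw).1.
have wwu : wderiv (wderiv u) = wderiv v by apply: wderiv_ae => //; case: wu.
have vw' := wderiv_C1 vw.
have BQ : 0 <= B * weight_norm by rewrite mulr_ge0// sqrtr_ge0.
rewrite /Hknorm 3!big_ord_recr big_ord0/= add0r.
rewrite (L2norm_ae uv') wwu.
rewrite (L2norm_ae vw').
(* The factor 2 absorbs three squares: [3 * b ^+ 2 <= (2 * b) ^+ 2]. *)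
have -> : 2 * (B * weight_norm) = Num.sqrt ((2 * (B * weight_norm)) ^+ 2).
  by rewrite sqrtr_sqr ger0_norm// mulr_ge0.
rewrite ler_wsqrtr//.
have sq (p : R) : 0 <= p -> p <= B * weight_norm -> p ^+ 2 <= (B * weight_norm) ^+ 2.
  by move=> p0 pB; rewrite ler_sqr ?nnegrE.
have L2norm_ge0 (z : R -> 'rV[R]_n) : 0 <= L2norm z by exact: sqrtr_ge0.
have := sq _ (L2norm_ge0 u) uN; have := sq _ (L2norm_ge0 v) vN.
have := sq _ (L2norm_ge0 w) wN; have := sqr_ge0 (B * weight_norm).
move: (B * weight_norm) => b; rewrite exprMn; lra.
Qed.

Lemma L2_scale u k : L2 u -> L2 (fun x => k *: u x).
Proof.
move=> Lu i.
have -> : (fun x => (k *: u x) ord0 i) = k \o* (fun x => u x ord0 i).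
  by apply/funext => x; rewrite mxE mulrC.
by apply: Lfun_scale; rewrite ?ler1n//; exact: Lu.
Qed.

Lemma L2_add u v : L2 u -> L2 v -> L2 (fun x => u x + v x).
Proof.
move=> Lu Lv i; have p1 : (1 <= 2%:E :> \bar R)%E by rewrite lee_fin ler1n.
have -> : (fun x => (u x + v x) ord0 i) =
    (fun x => u x ord0 i) + (fun x => v x ord0 i).
  by apply/funext => x; rewrite mxE.
exact: ((Lfun_addr_closed mu p1).2 _ _ (Lu i) (Lv i)).
Qed.

Lemma L2dotZl u v k : L2 u -> L2 v ->
  L2dot (fun x => k *: u x) v = k * L2dot u v.
Proof.
move=> Lu Lv; rewrite /L2dot -RintegralZl//; last exact: dot_integrable.
apply: eq_Rintegral => x _; rewrite /dot mulr_sumr; apply: eq_bigr => i _.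
by rewrite mxE mulrA.
Qed.

Lemma L2dotBl u v w : L2 u -> L2 v -> L2 w ->
  L2dot (fun x => u x - v x) w = L2dot u w - L2dot v w.
Proof.
move=> Lu Lv Lw; rewrite /L2dot -RintegralB//; try exact: dot_integrable.
apply: eq_Rintegral => x _; rewrite /dot -sumrB; apply: eq_bigr => i _.
by rewrite !mxE mulrBl.
Qed.

End Dominated.

(** * The dilated wave *)

Section DilatedWave.
Context {R : realType} {n : nat}.
Variables (rho c0 C Kg theta : R) (f g : 'rV[R]_n -> 'rV[R]_n).
Variables (P P1 P2 psi : R -> 'rV[R]_n) (chi_low chi_high : R -> R).

(** The second condition keeps the pairing of the dilated derivative with [psi] within one half of
    1, where the low cut-off is the identity. The third keeps the noise pairing inside the slack
    [2 * Kg] that [K_ip] leaves beyond the norm of [g (P)]. *)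
Definition admissible_dilation (a : R) :=
  [/\ 1 <= a, C * (a ^+ 2 - 1) * @weight_norm R n * L2norm psi <= 2^-1 &
   `|theta| * (C * (a ^+ 2 - 1) * @weight_norm R n) <= 2 * Kg].

(** The pairing [p] of the dilated derivative with [psi] is not 1 in general, but it occurs in both
    inner products and cancels in the quotient. *)
Lemma b_fun_dilated (a : R) : 0 <= C -> C1_pair P P1 -> C1_pair P1 P2 ->
  L2 P1 -> L2 psi -> L2dot P1 psi = 1 -> (forall x, g (P x) = theta *: P1 x) ->
  (forall x i, `|(a *: P1 (a * x) - P1 x) ord0 i| <=
       C * (a ^+ 2 - 1) * ((1 + `|x|) * weight x)) ->
  cutoff_low chi_low -> cutoff_high (K_ip g Kg P psi) chi_high ->
  admissible_dilation a ->
  b_fun chi_low chi_high g (fun x => P (a * x)) psi = - (a^-1 * theta).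
Proof.
move=> C0 C1 C2 LP1 Lpsi P1psi gP d1 [_ _ _ _ lowE] [_ _ _ highE _] [a1 e1 e2].
have a0 : 0 < a by rewrite (lt_le_trans ltr01).
have s0 : 0 <= a ^+ 2 - 1 by nra.
set Q := @weight_norm R n in e1 e2.
set u := fun x => P (a * x).
set u1 := fun x => a *: P1 (a * x).
have Cu : C1_pair u u1 by exact: C1_pair_dilate.
have Cu1 := C1_pair_scale a (C1_pair_dilate a C2).
have Cd := C1_pair_sub Cu1 C2.
have [Ld Nd] := L2_dominated (mulr_ge0 C0 s0) (C1_pair_measurable Cd).1 d1.
have Lu1 : L2 u1.
  have := L2_add Ld LP1; congr L2; apply/funext => x; exact: subrK.
have -> : b_fun chi_low chi_high g u psi =
   - (chi_low (L2dot u1 psi))^-1 * chi_high (a^-1 * theta * L2dot u1 psi).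
  rewrite /b_fun (L2dot_ae (wderiv_C1 Cu) (ae_eq_fun_refl psi)).
  congr (_ * chi_high _); rewrite -L2dotZl//; congr L2dot.
  by apply/funext => x; rewrite /u gP /u1 scalerA mulrAC mulVf ?mul1r// gt_eqF.
set p := L2dot u1 psi.
have N0 : 0 <= L2norm psi by exact: sqrtr_ge0.
have pE : `|p - 1| <= C * (a ^+ 2 - 1) * Q * L2norm psi.
  have -> : p - 1 = L2dot (fun x => u1 x - P1 x) psi by rewrite L2dotBl// P1psi.
  apply: le_trans (L2dot_CauchySchwarz Ld Lpsi) _.
  exact: ler_wpM2r N0 _ _ Nd.
have /andP[p1 p2] : 2^-1 <= p <= 1 + C * (a ^+ 2 - 1) * Q * L2norm psi.
  by move: pE; rewrite ler_norml => /andP[]; lra.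
rewrite lowE// highE.
  by field; rewrite !gt_eqF//; lra.
rewrite !normrM normfV (gtr0_norm a0) (ger0_norm (_ : 0 <= p)); last lra.
(* The normalisation of [psi] makes [theta] the pairing of [g (P)] with [psi], so the first summand
   of [K_ip] bounds [|theta|] and the second is left for the excess of [p] over 1. *)
have hK : `|theta| <= L2norm (fun x => g (P x)) * L2norm psi.
  have -> : `|theta| = `|L2dot (fun x => g (P x)) psi|.
    rewrite (_ : (fun x => g (P x)) = (fun x => theta *: P1 x)); last exact/funext.
    by rewrite L2dotZl// P1psi mulr1.
  apply: L2dot_CauchySchwarz => //.
  rewrite (_ : (fun x => g (P x)) = (fun x => theta *: P1 x)); last exact/funext.
  exact: L2_scale.
rewrite /K_ip mulrDl.
have h1 : a^-1 * `|theta| * p <= `|theta| * p.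
  rewrite -mulrA ler_piMl ?mulr_ge0 ?invf_le1//; lra.
have h2 : `|theta| * p <= `|theta| * (1 + C * (a ^+ 2 - 1) * Q * L2norm psi).
  by rewrite ler_wpM2l.
have h3 : `|theta| * (C * (a ^+ 2 - 1) * Q) * L2norm psi <= 2 * Kg * L2norm psi.
  by rewrite ler_wpM2r.
rewrite mulrDr mulr1 in h2; rewrite mulrA -mulrA in h3.
move: h1 h2 h3 hK; rewrite !mulrA; lra.
Qed.

End DilatedWave.

(** Three facts combine: [kappa] is [(2 * a ^+ 2 - 1) / a ^+ 2], the noise drift is
    [- 2 * rho * (a ^+ 2 - 1) * p2], and the wave equation turns the remaining terms into
    [- rho * p2]. The bracket sums to [- rho * (2 * a ^+ 2 - 1) * p2]; dividing by [kappa] leaves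
    [- rho * a ^+ 2 * p2], which the diffusion term cancels. *)
Lemma dilated_equation_coord {R : realType} (rho c0 sigma theta a F p1 p2 : R) :
  0 < rho -> 0 < a -> a ^+ 2 = 1 + (2 * rho)^-1 * sigma ^+ 2 * theta ^+ 2 ->
  p2 = - rho^-1 * (c0 * p1 + F) ->
  rho * (a * (a * p2)) +
  (1 + (2 * rho)^-1 * sigma ^+ 2 * (- (a^-1 * theta)) ^+ 2)^-1 *
   (F + a^-1 * c0 * (a * p1) +
    sigma ^+ 2 * - (a^-1 * theta) * (a^-1 * theta * (a * (a * p2)))) = 0.
Proof.
move=> rho0 a0 aE p2E; have an0 : a != 0 by rewrite gt_eqF.
have rn0 : rho != 0 by rewrite gt_eqF.
have a1 : 1 <= a ^+ 2.
  rewrite aE lerDl; apply: mulr_ge0; last exact: sqr_ge0.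
  by apply: mulr_ge0; rewrite ?sqr_ge0// invr_ge0 mulr_ge0// ltW.
have kE : 1 + (2 * rho)^-1 * sigma ^+ 2 * (- (a^-1 * theta)) ^+ 2 =
    (2 * a ^+ 2 - 1) / a ^+ 2.
  have -> : (2 * rho)^-1 * sigma ^+ 2 * (- (a^-1 * theta)) ^+ 2 =
     ((2 * rho)^-1 * sigma ^+ 2 * theta ^+ 2) / a ^+ 2 by field; apply/andP.
  have -> : (2 * rho)^-1 * sigma ^+ 2 * theta ^+ 2 = a ^+ 2 - 1 by rewrite aE; ring.
  by field.
have sE : sigma ^+ 2 * - (a^-1 * theta) * (a^-1 * theta * (a * (a * p2))) =
    - (2 * rho * (a ^+ 2 - 1) * p2).
  by rewrite aE; field; apply/andP.
have FE : F + a^-1 * c0 * (a * p1) = - rho * p2.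
  by rewrite p2E; field; apply/andP.
rewrite kE sE FE; have h : 2 * a ^+ 2 - 1 != 0 by rewrite gt_eqF//; lra.
by field; apply/andP.
Qed.

Section DilatedEquation.
Context {R : realType} {n : nat}.
Variables (rho c0 sigma theta a : R) (f g : 'rV[R]_n -> 'rV[R]_n).
Variables (P P1 P2 psi : R -> 'rV[R]_n) (chi_low chi_high : R -> R).

Lemma dilated_noise : 0 < a -> (forall x, g (P x) = theta *: P1 x) ->
  (fun x => g (P (a * x))) = (fun x => (a^-1 * theta) *: (a *: P1 (a * x))).
Proof.
move=> a0 gP; apply/funext => x.
by rewrite gP scalerA mulrAC mulVf ?mul1r// gt_eqF.
Qed.

Lemma dilated_equation : 0 < rho -> 0 < a ->
  a ^+ 2 = 1 + (2 * rho)^-1 * sigma ^+ 2 * theta ^+ 2 ->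
  C1_pair P P1 -> C1_pair P1 P2 ->
  (forall x i, P2 x ord0 i = - rho^-1 * (c0 * P1 x ord0 i + f (P x) ord0 i)) ->
  (forall x, g (P x) = theta *: P1 x) ->
  b_fun chi_low chi_high g (fun x => P (a * x)) psi = - (a^-1 * theta) ->
  ae_eq_fun
    (fun x => A_star rho (fun x => P (a * x)) x +
       J_fun chi_low chi_high rho f g sigma (fun x => P (a * x)) (a^-1 * c0) psi x)
    (fun=> 0).
Proof.
move=> rho0 a0 aE C1 C2 ode gP bE; have F := @ae_filter R.
have Cu := C1_pair_dilate a C1.
have Cu1 := C1_pair_scale a (C1_pair_dilate a C2).
have w1 := wderiv_C1 Cu; have w2 := wderiv_wderiv_C1 Cu Cu1.
have w3 := wderiv_C1 (C1_pair_scale (a^-1 * theta) Cu1).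
apply: (filterS3 _ _ w1 w2 w3) => x e1 e2 e3.
rewrite /A_star /J_fun /kappa bE (dilated_noise a0 gP) e1 e2 e3.
apply/rowP => i; rewrite !mxE; apply: dilated_equation_coord => //.
Qed.

End DilatedEquation.

(** * Selection of the dilated wave by uniqueness *)

Lemma quadratic_small {R : realType} (A e : R) : 0 <= A -> 0 < e ->
  exists2 d : R, 0 < d & forall s, 0 <= s -> s <= d -> A * s ^+ 2 <= e.
Proof.
move=> A0 e0; exists (Num.min 1 (e / (A + 1))).
  by rewrite lt_min ltr01/= divr_gt0// ltr_wpDl.
move=> s s0; rewrite le_min ler_pdivlMr ?ltr_wpDl// => /andP[s1 se].
have : s ^+ 2 <= s by rewrite expr2 ler_piMl.
nra.
Qed.

Section Selection.
Context {R : realType} {n : nat}.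
Variables (rho c0 C Kg : R) (f g : 'rV[R]_n -> 'rV[R]_n).
Variables (P P1 P2 psi : R -> 'rV[R]_n) (chi_low chi_high : R -> R).

Lemma dilated_wave_pair (theta K sigma a : R) :
  0 < rho -> 0 <= C -> C1_pair P P1 -> C1_pair P1 P2 ->
  (forall x i, P2 x ord0 i = - rho^-1 * (c0 * P1 x ord0 i + f (P x) ord0 i)) ->
  (forall a, 1 <= a -> forall x i, [/\
    `|(P (a * x) - P x) ord0 i| <= C * (a ^+ 2 - 1) * ((1 + `|x|) * weight x),
    `|(a *: P1 (a * x) - P1 x) ord0 i| <=
       C * (a ^+ 2 - 1) * ((1 + `|x|) * weight x) &
    `|(a *: (a *: P2 (a * x)) - P2 x) ord0 i| <=
       C * (a ^+ 2 - 1) * ((1 + `|x|) * weight x)]) ->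
  (forall x, g (P x) = theta *: P1 x) ->
  1 <= a -> a ^+ 2 = 1 + (2 * rho)^-1 * sigma ^+ 2 * theta ^+ 2 ->
  b_fun chi_low chi_high g (fun x => P (a * x)) psi = - (a^-1 * theta) ->
  (2 * (C * @weight_norm R n) + `|c0|) * (a ^+ 2 - 1) <= K * sigma ^+ 2 ->
  wave_pair chi_low chi_high rho f g P c0 psi K sigma (fun x => P (a * x)) (a^-1 * c0).
Proof.
move=> rho0 C0 C1 C2 ode dil gP a1 aE bE hK.
have a0 : 0 < a by rewrite (lt_le_trans ltr01).
have s0 : 0 <= a ^+ 2 - 1 by nra.
have Cu := C1_pair_dilate a C1.
have Cu1 := C1_pair_scale a (C1_pair_dilate a C2).
have [H2 HN] := Hk2_dominated (mulr_ge0 C0 s0) (C1_pair_sub Cu C1)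
  (C1_pair_sub Cu1 C2) (dil a a1).
split=> //; first exact: (dilated_equation rho0 a0 aE).
(* From [1 - a^-1 <= a - 1 <= a ^+ 2 - 1]. *)
have cE : `|a^-1 * c0 - c0| <= `|c0| * (a ^+ 2 - 1).
  rewrite (_ : _ - _ = c0 * (a^-1 - 1)); last by ring.
  rewrite normrM ler_wpM2l// distrC ger0_norm ?subr_ge0 ?invf_le1//.
  have : a^-1 * a = 1 by rewrite mulVf// gt_eqF.
  have : 0 <= a^-1 by rewrite invr_ge0 ltW.
  nra.
by move: HN cE hK; lra.
Qed.

Lemma dilated_wave_selected :
  0 < rho -> 0 <= C -> 0 < Kg -> C1_pair P P1 -> C1_pair P1 P2 ->
  (forall x i, P2 x ord0 i = - rho^-1 * (c0 * P1 x ord0 i + f (P x) ord0 i)) ->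
  (forall a, 1 <= a -> forall x i, [/\
    `|(P (a * x) - P x) ord0 i| <= C * (a ^+ 2 - 1) * ((1 + `|x|) * weight x),
    `|(a *: P1 (a * x) - P1 x) ord0 i| <=
       C * (a ^+ 2 - 1) * ((1 + `|x|) * weight x) &
    `|(a *: (a *: P2 (a * x)) - P2 x) ord0 i| <=
       C * (a ^+ 2 - 1) * ((1 + `|x|) * weight x)]) ->
  L2 P1 -> L2 psi -> L2dot P1 psi = 1 ->
  cutoff_low chi_low -> cutoff_high (K_ip g Kg P psi) chi_high ->
  exists2 K0 : R, 0 < K0 &
  forall K delta_sigma : R, K0 <= K -> 0 < delta_sigma ->
  (forall sigma : R, 0 <= sigma <= delta_sigma ->
     unique_wave_pair chi_low chi_high rho f g P c0 psi K sigma) ->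
  forall theta0 : R, (forall x, g (P x) = theta0 *: P1 x) ->
  exists2 delta0 : R, 0 < delta0 &
  forall sigma : R, 0 <= sigma <= delta_sigma -> sigma <= delta0 ->
  forall (Phi : R -> 'rV[R]_n) (c : R),
  wave_pair chi_low chi_high rho f g P c0 psi K sigma Phi c ->
  let alpha := Num.sqrt (1 + (2 * rho)^-1 * sigma ^+ 2 * theta0 ^+ 2) in
  [/\ ae_eq_fun Phi (fun xi => P (alpha * xi)),
      c = alpha^-1 * c0,
      ae_eq_fun (fun xi => g (Phi xi))
                (fun xi => (alpha^-1 * theta0) *: wderiv Phi xi) &
      ae_eq_fun (fun xi => (alpha^-1 * theta0) *: wderiv Phi xi)
                (fun xi => - b_fun chi_low chi_high g Phi psi
                             *: wderiv Phi xi)].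
Proof.
move=> rho0 C0 Kg0 C1 C2 ode dil LP1 Lpsi P1psi hlow hhigh.
have N0 : 0 <= L2norm psi by exact: sqrtr_ge0.
set Q := @weight_norm R n; have Q0 : 0 <= Q by exact: sqrtr_ge0.
(* [theta0 = <g(P), psi>], so [K0] can be chosen before [theta0]. *)
pose q := (2 * rho)^-1 * L2dot (fun x => g (P x)) psi ^+ 2.
have q0 : 0 <= q by rewrite mulr_ge0 ?sqr_ge0// invr_ge0 mulr_ge0// ltW.
have T0 : 0 <= 2 * (C * Q) + `|c0| by rewrite addr_ge0// !mulr_ge0.
(* [a ^+ 2 - 1] will be [q * sigma ^+ 2]; the first summand bounds profile and speed together, and
   the 1 makes the constant positive. *)
exists ((2 * (C * Q) + `|c0|) * q + 1).
  by rewrite ltr_wpDl// mulr_ge0.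
move=> K dsigma K0K dsigma0 uniq theta gP.
have qE : q = (2 * rho)^-1 * theta ^+ 2.
  have gPE : (fun x => g (P x)) = (fun x => theta *: P1 x) by exact/funext.
  by rewrite /q gPE L2dotZl// P1psi mulr1.
have CqQ0 := mulr_ge0 (mulr_ge0 C0 q0) Q0.
have half0 : 0 < 2^-1 :> R by rewrite invr_gt0.
have Kg20 : 0 < 2 * Kg by rewrite mulr_gt0.
(* [d1] and [d2] serve the two smallness conditions of [admissible_dilation], both quadratic in
   [sigma]. *)
have [d1 d10 hd1] := quadratic_small (mulr_ge0 CqQ0 N0) half0.
have [d2 d20 hd2] := quadratic_small (mulr_ge0 (normr_ge0 theta) CqQ0) Kg20.
exists (Num.min d1 d2); first by rewrite lt_min d10.
move=> sigma /[dup] hsigma /andP[sigma0 _]; rewrite le_min => /andP[s1 s2].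
move=> Phi c hPhi alpha.
have aE : alpha ^+ 2 = 1 + (2 * rho)^-1 * sigma ^+ 2 * theta ^+ 2.
  rewrite sqr_sqrtr// addr_ge0// mulr_ge0 ?sqr_ge0// mulr_ge0 ?sqr_ge0//.
  by rewrite invr_ge0 mulr_ge0// ltW.
have sE : alpha ^+ 2 - 1 = q * sigma ^+ 2 by rewrite aE qE; ring.
have a1 : 1 <= alpha.
  rewrite -(@ler_pXn2r _ 2) ?nnegrE ?sqrtr_ge0// expr1n -subr_ge0 sE.
  by rewrite mulr_ge0// sqr_ge0.
have a0 : 0 < alpha by rewrite (lt_le_trans ltr01).
have adm : @admissible_dilation R n C Kg theta psi alpha.
  split=> //; rewrite sE.
    by have := hd1 _ sigma0 s1; rewrite -/Q; congr (_ <= _); ring.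
  by have := hd2 _ sigma0 s2; rewrite -/Q; congr (_ <= _); ring.
have d1b x i : `|(alpha *: P1 (alpha * x) - P1 x) ord0 i| <=
    C * (alpha ^+ 2 - 1) * ((1 + `|x|) * weight x).
  by have [] := dil alpha a1 x i.
have bE := b_fun_dilated C0 C1 C2 LP1 Lpsi P1psi gP d1b hlow hhigh adm.
have wp : wave_pair chi_low chi_high rho f g P c0 psi K sigma
    (fun x => P (alpha * x)) (alpha^-1 * c0).
  apply: (dilated_wave_pair rho0 C0 C1 C2 ode dil gP a1 aE bE).
  rewrite sE (mulrA _ q) ler_wpM2r ?sqr_ge0//; apply: le_trans K0K.
  by rewrite lerDl.
have [_ /(_ _ _ _ _ hPhi wp)[PhiE cE]] := uniq sigma hsigma.
have F := @ae_filter R.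
have Cu := C1_pair_dilate alpha C1.
(* Local integrability of [Phi - P] comes with its weak derivative; adding the continuous [P] back
   gives that of [Phi]. *)
have lPhi : coord_locint Phi.
  have [[_ [v [ld _ _] _]] _ _] := hPhi; have [lP _] := C1_pair_coord_locint C1.
  move=> i; have := locally_integrableD (ld i) (lP i).
  by congr locally_integrable; apply/funext => x /=; rewrite !mxE subrK.
(* [Phi] is the dilated wave only almost everywhere, yet the two chosen derivatives are the same
   function, so [b_fun] transfers to [Phi] by rewriting. *)
have wE : wderiv Phi = wderiv (fun x => P (alpha * x)).
  by apply: wderiv_ae => //; have [] := C1_pair_coord_locint Cu.
have w1 := wderiv_C1 Cu.
have gPhi : ae_eq_fun (fun x => g (Phi x)) (fun x => g (P (alpha * x))).
  by apply: filterS PhiE => x ->.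
split=> //.
  apply: ae_eq_fun_trans gPhi _; rewrite wE (dilated_noise a0 gP).
  by apply: filterS w1 => x ->.
have -> : b_fun chi_low chi_high g Phi psi =
    b_fun chi_low chi_high g (fun x => P (alpha * x)) psi.
  by rewrite /b_fun wE (L2dot_ae gPhi (ae_eq_fun_refl psi)).
by rewrite bE opprK; exact: ae_eq_fun_refl.
Qed.

End Selection.

Theorem proposition2p6 (R : realType) (n : nat) (hn : (1 <= n)%N)
    (rho : R) (f : 'rV[R]_n -> 'rV[R]_n) (um up : 'rV[R]_n)
    (Phi0 : R -> 'rV[R]_n) (c0 : R) (psi_tw : R -> 'rV[R]_n)
    (g : 'rV[R]_n -> 'rV[R]_n) (Kg : R) (chi_low chi_high : R -> R)
    (hrho : 0 < rho)
    (hf : nonlinearity_assumption f um up)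
    (hwave : wave_assumption rho f um up Phi0 c0)
    (hspec : spectral_assumption rho f Phi0 c0 psi_tw)
    (hg : noise_assumption g Kg um up)
    (hlow : cutoff_low chi_low)
    (hhigh : cutoff_high (K_ip g Kg Phi0 psi_tw) chi_high) :
  exists2 K0 : R, 0 < K0 &
  forall K delta_sigma : R, K0 <= K -> 0 < delta_sigma ->
  (forall sigma : R, 0 <= sigma <= delta_sigma ->
     unique_wave_pair chi_low chi_high rho f g Phi0 c0 psi_tw K sigma) ->
  forall theta0 : R, (forall x, g (Phi0 x) = theta0 *: derive1 Phi0 x) ->
  exists2 delta0 : R, 0 < delta0 &
  forall sigma : R, 0 <= sigma <= delta_sigma -> sigma <= delta0 ->
  forall (Phi : R -> 'rV[R]_n) (c : R),
  wave_pair chi_low chi_high rho f g Phi0 c0 psi_tw K sigma Phi c ->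
  let alpha := Num.sqrt (1 + (2 * rho)^-1 * sigma ^+ 2 * theta0 ^+ 2) in
  [/\ ae_eq_fun Phi (fun xi => Phi0 (alpha * xi)),
      c = alpha^-1 * c0,
      ae_eq_fun (fun xi => g (Phi xi))
                (fun xi => (alpha^-1 * theta0) *: wderiv Phi xi) &
      ae_eq_fun (fun xi => (alpha^-1 * theta0) *: wderiv Phi xi)
                (fun xi => - b_fun chi_low chi_high g Phi psi_tw
                             *: wderiv Phi xi)].
Proof.
have [[df cf] _ fum fup] := hf; have [CPhi rde _] := hwave.
have Cf : Ck 1 f.
  by split=> // v x; apply: differentiable_continuous; have [] := cf v.
have [C0' C1'] := Ck2_Ck1 CPhi.
(* Square integrability of [derive1 Phi0] and [psi_tw] is part of their spanning kernels inside
   H^2. *)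
have [_ _ [[LP1 _] _] [[Lpsi _] _] P1psi] := hspec.
have [_ _ Kg0 _ _] := hg.
have [C C0 dil] := dilated_wave_bounds hrho Cf fum fup hwave.
exact: (dilated_wave_selected hrho C0 Kg0 (Ck1_C1_pair C0') (Ck1_C1_pair C1')
  (wave_profile_ODE_coord hrho C0' rde) dil LP1 Lpsi P1psi hlow hhigh).
Qed.
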